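(* Let $G$ be a group acting by automorphisms on an abelian group $A$, where $G$, $A$ and the action of $G$ on $A$ are $\emptyset$-definable in a first-order structure $\mathcal G$. Let $B\subset\mathcal G$ be a finite parameter set and let $h\colon G\times G\to A$ be a 2-cocycle which is $B$-definable in $\mathcal G$ and has finite image $\mathrm{Im}(h)\subseteq\mathrm{dcl}(B)$. Let $A_0\le A$ be the subgroup generated by $\mathrm{Im}(h)$. Let $\mathcal G^*\succ\mathcal G$ be a monster model, and let $A_1^*$ be a bounded index subgroup of $A^*$ which is type-definable over $B$ and invariant under the action of $G^*$. Let $\widetilde{G}$ be the extension of $G$ by $A$ defined by $h$ and $\widetilde{G^*}$ its interpretation in $\mathcal G^*$. Assume that: (1) the 2-cocycle $h\colon G\times G\to A_0$ is non-split (via a function taking values in $A_0$); (2) $A_1^*\cap A_0$ is trivial and $A_0$ is torsion free (and so $A_0\cong\mathbb Z^n$ for some $n$); (3) ${G^*}^{00}_B=G^*$. Then $\widetilde{G^*}^{000}_B\ne\widetilde{G^*}^{00}_B$. Suppose furthermore that ${G^*}^{000}_B=G^*$ and: (4) for every proper subgroup $Z\lneqq A_0=\mathbb Z^n$ the induced 2-cocycle $\overline h\colon G\times G\to A_0/Z$ is non-split; (5) if $H\le A^*$ is a subgroup of $A^*$ of bounded index which is type-definable over $B$ (in $\mathcal G^*$) and contains $A_0$, then $H=A^*$. Then $\widetilde{G^*}^{00}_B=\widetilde{G^*}$.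
   Context: Cocycles. If a group $G$ acts by automorphisms on an abelian group $A$ (written additively), a 2-cocycle is a map $h\colon G\times G\to A$ with $h(g_1,g_2)+h(g_1g_2,g_3)=h(g_1,g_2g_3)+g_1\cdot h(g_2,g_3)$ and $h(g,e)=h(e,g)=0$ for all $g,g_1,g_2,g_3\in G$. It defines the extension $\widetilde G=A\times G$ with product $(a_1,g_1)*(a_2,g_2)=(a_1+g_1\cdot a_2+h(g_1,g_2),\,g_1g_2)$. The 2-cocycle $h$ is split if there is $f\colon G\to A$ with $f(e)=0$ and $h(g_1,g_2)=f(g_1)+g_1\cdot f(g_2)-f(g_1g_2)$ for all $g_1,g_2\in G$; it is non-split otherwise. For a $G$-invariant subgroup $Z\le A_0$, the induced 2-cocycle $\overline h\colon G\times G\to A_0/Z$ is the composition of $h$ with the quotient map. (The group $A_0$ is $G$-invariant; when ${G^*}^{00}_B=G^*$, $G$ acts trivially on $A_0$, so every subgroup of $A_0$ is $G$-invariant.) Model theory. A monster model $\mathcal G^*\succ\mathcal G$ is a $\kappa$-saturated, strongly $\kappa$-homogeneous elementary extension for a sufficiently large cardinal $\kappa$; ''small'' and ''bounded'' mean of cardinality $<\kappa$. For an object $X$ definable in $\mathcal G$, $X^*$ denotes its interpretation in $\mathcal G^*$. For a group $K$ definable over $B$ in $\mathcal G^*$: $K^{00}_B$ is the smallest subgroup of $K$ of bounded index which is type-definable over $B$, and $K^{000}_B$ is the smallest subgroup of $K$ of bounded index which is invariant under $\mathrm{Aut}(\mathcal G^*/B)$. *)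

(* Defs.v *)
From HB Require Import structures.
From mathcomp Require Import all_boot all_algebra.
From mathcomp Require Import ring_quotient.
From mathcomp Require Import all_classical.

Set Implicit Arguments.
Unset Strict Implicit.
Unset Printing Implicit Defensive.

Import GRing.Theory.

Local Open Scope classical_set_scope.
Local Open Scope ring_scope.
Local Open Scope quotient_scope.
Local Open Scope card_scope.

(******************************************************************************)
(*                       First-order logic with equality                      *)
(******************************************************************************)

Record signature := Signature {
  fun_sym : Type;
  rel_sym : Type;
  fun_ar : fun_sym -> nat;
  rel_ar : rel_sym -> nat }.

(* Formulas are well scoped: the free variables of [p : formula L V] are      *)
(* elements of the type [V], and the variable bound by [All] is [None].       *)
(* Parameters are free variables too: a formula in the variables [V] with     *)
(* parameters from [P] has type [formula L (V + P)], and the elements of [P]  *)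
(* receive their own values when it is evaluated (see [join] below).          *)
Inductive term (L : signature) (V : Type) : Type :=
| Var (x : V)
| App (f : fun_sym L) (t : 'I_(fun_ar f) -> term L V).

Inductive formula (L : signature) (V : Type) : Type :=
| Falsum
| Equal (s t : term L V)
| Rel (r : rel_sym L) (t : 'I_(rel_ar r) -> term L V)
| Imp (p q : formula L V)
| All (p : formula L (option V)).

Record structure (L : signature) := Structure {
  carrier :> Type;
  fun_int : forall f : fun_sym L, ('I_(fun_ar f) -> carrier) -> carrier;
  rel_int : forall r : rel_sym L, ('I_(rel_ar r) -> carrier) -> Prop }.

Fixpoint eval L (M : structure L) (V : Type) (v : V -> M) (t : term L V) : M :=
  match t with
  | Var x => v x
  | App f u => fun_int (fun i => eval v (u i))
  end.

Definition extend (T V : Type) (x : T) (v : V -> T) (o : option V) : T :=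
  if o is Some y then v y else x.

Fixpoint sat L (M : structure L) (V : Type) (p : formula L V) : (V -> M) -> Prop :=
  match p with
  | Falsum => fun=> False
  | Equal s t => fun v => eval v s = eval v t
  | Rel r u => fun v => rel_int (fun i => eval v (u i))
  | Imp p q => fun v => sat p v -> sat q v
  | All p => fun v => forall x : M, sat p (extend x v)
  end.

(* Concatenation of tuples. *)
Definition join (T V W : Type) (x : V -> T) (y : W -> T) (u : V + W) : T :=
  match u with inl i => x i | inr j => y j end.

Section Definability.
Variables (L : signature) (M : structure L).

(* [holds C p x]: the formula [p], with parameters from [C], holds at [x]. *)
Definition holds (C : set M) (V : Type) (p : formula L (V + C)) (x : V -> M) : Prop :=
  sat p (join x (fun c : C => val c)).

Definition type_definable (C : set M) (V : Type) (X : set (V -> M)) : Prop :=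
  exists S : set (formula L (V + C)),
    X = [set x | forall p, S p -> holds p x].

Definition dcl (C : set M) : set M :=
  [set a | exists p : formula L (unit + C),
     forall x : unit -> M, holds p x <-> x tt = a].

Definition automorphism (s : M -> M) : Prop :=
  [/\ bijective s,
      forall (f : fun_sym L) (x : 'I_(fun_ar f) -> M),
        s (fun_int x) = fun_int (s \o x) &
      forall (r : rel_sym L) (x : 'I_(rel_ar r) -> M),
        rel_int x <-> rel_int (s \o x)].

Definition Aut_invariant (C : set M) (V : Type) (X : set (V -> M)) : Prop :=
  forall s, automorphism s -> (forall c, C c -> s c = c) ->
  forall x, X x -> X (s \o x).

End Definability.

Definition elementary L (M N : structure L) (e : M -> N) : Prop :=
  forall (V : Type) (p : formula L V) (v : V -> M), sat p v <-> sat p (e \o v).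

(******************************************************************************)
(*                               Monster models                               *)
(******************************************************************************)

(* A cardinal kappa is given by a type [K] of that cardinality. *)
Definition small (K T : Type) (X : set T) : Prop := ~~ ([set: K] #<= X).

Definition saturated (K : Type) L (N : structure L) : Prop :=
  forall C : set N, small K C ->
  forall (V : finType) (S : set (formula L (V + C))),
    (forall S0, S0 `<=` S -> finite_set S0 ->
       exists x : V -> N, forall p, S0 p -> holds p x) ->
    exists x : V -> N, forall p, S p -> holds p x.

(* Every partial elementary map with small domain [C] extends to an           *)
(* automorphism; a formula over the variables [C] is evaluated at the         *)
(* enumeration of [C] by itself and at its image under [f].                   *)
Definition strongly_homogeneous (K : Type) L (N : structure L) : Prop :=
  forall (C : set N) (f : C -> N), small K C ->
    (forall p : formula L C, sat p (fun c : C => val c) <-> sat p f) ->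
    exists2 s : N -> N, automorphism s & forall c : C, s (val c) = f c.

(* "Sufficiently large" is read as 2 ^ (|M| + |L| + aleph_0) < kappa. *)
Definition sufficiently_large (K : Type) L (M : structure L) : Prop :=
  small K [set: set (M + (fun_sym L + rel_sym L) + nat)].

Definition monster (K : Type) L (M N : structure L) (e : M -> N) : Prop :=
  [/\ elementary e, sufficiently_large K M, saturated K N &
      strongly_homogeneous K N].

(******************************************************************************)
(*                       Actions, cocycles and extensions                     *)
(******************************************************************************)

Record autAction (G : groupType) (A : zmodType) := AutAction {
  act :> G -> A -> A;
  act_1 : forall a, act 1%g a = a;
  act_M : forall g1 g2 a, act (g1 * g2)%g a = act g1 (act g2 a);
  act_D : forall g a b, act g (a + b) = act g a + act g b }.

Record cocycle (G : groupType) (A : zmodType) (ac : autAction G A) := Cocycle {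
  coc :> G -> G -> A;
  coc_assoc : forall g1 g2 g3,
    coc g1 g2 + coc (g1 * g2)%g g3 = coc g1 (g2 * g3)%g + ac g1 (coc g2 g3);
  coc_g1 : forall g, coc g 1%g = 0;
  coc_1g : forall g, coc 1%g g = 0 }.

Definition extension (G : groupType) (A : zmodType) (ac : autAction G A)
  (h : cocycle ac) : Type := (A * G)%type.

Section Extension.
Variables (G : groupType) (A : zmodType) (ac : autAction G A) (h : cocycle ac).
Local Notation E := (extension h).

Definition ext_one : E := (0, 1%g).
Definition ext_mul (x y : E) : E :=
  (x.1 + ac x.2 y.1 + h x.2 y.2, (x.2 * y.2)%g).
Definition ext_inv (x : E) : E :=
  (- ac x.2^-1%g (x.1 + h x.2 x.2^-1%g), x.2^-1%g).

Lemma act_0 g : ac g 0 = 0.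
Proof. by apply: (addrI (ac g 0)); rewrite -act_D !addr0. Qed.

Lemma act_N g a : ac g (- a) = - ac g a.
Proof. by apply: (addrI (ac g a)); rewrite -act_D !subrr act_0. Qed.

Lemma ext_mulA : associative ext_mul.
Proof.
move=> [a g] [b k] [c l]; rewrite /ext_mul /= mulgA; congr pair.
rewrite !act_D act_M -!addrA; congr (_ + (_ + _)).
by rewrite [RHS]addrCA coc_assoc; congr (_ + _); rewrite addrC.
Qed.

Lemma ext_mul1 : left_id ext_one ext_mul.
Proof.
by move=> [a g]; rewrite /ext_mul /= act_1 coc_1g add0r addr0 mul1g.
Qed.

Lemma ext_mulg1 : right_id ext_one ext_mul.
Proof.
by move=> [a g]; rewrite /ext_mul /= act_0 coc_g1 !addr0 mulg1.
Qed.

Lemma coc_Vg g : ac g^-1%g (h g g^-1%g) = h g^-1%g g.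
Proof.
have := coc_assoc h g^-1%g g g^-1%g.
by rewrite mulVg mulgV coc_1g coc_g1 addr0 add0r.
Qed.

Lemma ext_mulV : left_inverse ext_one ext_inv ext_mul.
Proof.
move=> [a g]; rewrite /ext_mul /ext_inv /= mulVg act_D coc_Vg opprD.
by rewrite -addrA addrACA !addNr addr0.
Qed.

Lemma ext_mulgV : right_inverse ext_one ext_inv ext_mul.
Proof.
move=> [a g]; rewrite /ext_mul /ext_inv /= mulgV act_N -act_M mulgV act_1.
by rewrite opprD addrA subrr add0r addNr.
Qed.

HB.instance Definition _ := Choice.copy E (A * G)%type.
HB.instance Definition _ :=
  isGroup.Build E ext_mulA ext_mul1 ext_mulg1 ext_mulV ext_mulgV.

End Extension.

(* [h] is split via a function with values in the subset [S] of [Q]. *)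
Definition split_in (G : groupType) (Q : zmodType) (ac : G -> Q -> Q)
    (h : G -> G -> Q) (S : set Q) : Prop :=
  exists f : G -> Q,
    [/\ forall g, S (f g), f 1%g = 0 &
        forall g1 g2, h g1 g2 = f g1 + ac g1 (f g2) - f (g1 * g2)%g].

Section Quotient.
Variables (G : groupType) (A : zmodType) (ac : autAction G A).
Variable Z : zmodClosed A.

(* Despite its name, [ideal_quot] is the quotient A / Z of abelian groups. *)
Definition quot_act (g : G) (q : {ideal_quot Z}) : {ideal_quot Z} :=
  \pi_({ideal_quot Z}) (ac g (repr q)).

(* For a G-invariant [Z], [quot_act] is the induced action. *)
Lemma quot_actE : (forall g z, z \in Z -> ac g z \in Z) ->
  forall g a, quot_act g (\pi_({ideal_quot Z}) a)
              = \pi_({ideal_quot Z}) (ac g a).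
Proof.
move=> Zinv g a; rewrite /quot_act.
have: repr (\pi_({ideal_quot Z}) a) = a %[mod {ideal_quot Z}] by rewrite reprK.
move=> /eqmodP /= ra; apply/eqmodP => /=; move: ra.
by rewrite !Quotient.equivE -act_N -act_D; apply: Zinv.
Qed.

Definition quot_coc (h : cocycle ac) (g1 g2 : G) : {ideal_quot Z} :=
  \pi_({ideal_quot Z}) (h g1 g2).

Definition quot_image (S : set A) : set {ideal_quot Z} :=
  [set \pi_({ideal_quot Z}) a | a in S].

End Quotient.

Arguments quot_act {G A} ac Z g q.
Arguments quot_image {A} Z S _.

Definition coc_image (G : groupType) (A : zmodType) (ac : autAction G A)
    (h : cocycle ac) : set A :=
  [set a | exists g1 g2, h g1 g2 = a].

Definition generated (A : zmodType) (S : set A) : set A :=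
  smallest [set T : set A | zmod_closed (mem T)] S.

Definition torsion_free (A : zmodType) (S : set A) : Prop :=
  forall a, S a -> forall k : nat, (0 < k)%N -> a *+ k = 0 -> a = 0.

(******************************************************************************)
(*                      Definable groups and G-modules                        *)
(******************************************************************************)

Record module_formulas (L : signature) (n m : nat) := ModuleFormulas {
  G_dom : formula L 'I_n;
  G_mul : formula L ('I_n + 'I_n + 'I_n);
  A_dom : formula L 'I_m;
  A_add : formula L ('I_m + 'I_m + 'I_m);
  GA_act : formula L ('I_n + 'I_m + 'I_m) }.

(* The formulas [F] define in [M] the group [G], the abelian group [A] and    *)
(* the action, [iG] and [iA] being the inclusions of G in M ^ n and of A in   *)
(* M ^ m.  The interpretations of G, A and the action in an elementary        *)
(* extension are those interpreted there by the same formulas; up to a unique *)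
(* isomorphism commuting with the inclusions, they exist and are unique.      *)
Record interprets (L : signature) (n m : nat) (F : module_formulas L n m)
    (M : structure L) (G : groupType) (A : zmodType) (ac : autAction G A)
    (iG : G -> ('I_n -> M)) (iA : A -> ('I_m -> M)) : Prop := Interprets {
  iG_inj : injective iG;
  iG_range : range iG = [set x | sat (G_dom F) x];
  iG_mul : forall x y z : G,
    (x * y)%g = z <-> sat (G_mul F) (join (join (iG x) (iG y)) (iG z));
  iA_inj : injective iA;
  iA_range : range iA = [set x | sat (A_dom F) x];
  iA_add : forall a b c : A,
    a + b = c <-> sat (A_add F) (join (join (iA a) (iA b)) (iA c));
  iGA_act : forall (g : G) (a b : A),
    ac g a = b <-> sat (GA_act F) (join (join (iG g) (iA a)) (iA b)) }.

(* The formula [p], with parameters evaluated by [b], defines the graph of    *)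
(* [h].                                                                       *)
Definition interprets_cocycle (L : signature) (n m : nat) (P : Type)
    (p : formula L ('I_n + 'I_n + 'I_m + P)) (M : structure L) (b : P -> M)
    (G : groupType) (A : zmodType) (ac : autAction G A)
    (iG : G -> ('I_n -> M)) (iA : A -> ('I_m -> M)) (h : cocycle ac) : Prop :=
  forall g1 g2 a,
    h g1 g2 = a <-> sat p (join (join (join (iG g1) (iG g2)) (iA a)) b).

Definition ext_incl (T V W : Type) (G : groupType) (A : zmodType)
    (ac : autAction G A) (h : cocycle ac)
    (iG : G -> (V -> T)) (iA : A -> (W -> T)) (x : extension h) : W + V -> T :=
  join (iA x.1) (iG x.2).

(* The copy in X^* of a subset [S] of a definable X, with inclusions [iX] and *)
(* [iXs], along the elementary embedding [e].                                 *)
Definition transfer (T U V X Xs : Type) (e : T -> U)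
    (iX : X -> (V -> T)) (iXs : Xs -> (V -> U)) (S : set X) : set Xs :=
  [set y | exists2 x, S x & iXs y = e \o iX x].

(******************************************************************************)
(*                            Connected components                            *)
(******************************************************************************)

Definition bounded_index (K : Type) (X : groupType) (H : set X) : Prop :=
  small K [set [set (x * y)%g | y in H] | x in [set: X]].

Definition bounded_index_add (K : Type) (X : zmodType) (H : set X) : Prop :=
  small K [set [set x + y | y in H] | x in [set: X]].

Definition is_smallest (T : Type) (P : set T -> Prop) (H : set T) : Prop :=
  P H /\ forall H', P H' -> H `<=` H'.

Section Components.
Variables (K : Type) (L : signature) (N : structure L) (C : set N).
Variables (V : Type) (X : groupType) (iX : X -> (V -> N)).

Definition is_component00 : set X -> Prop :=
  is_smallest (fun H => [/\ group_closed (mem H), bounded_index K H &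
                            type_definable C (iX @` H)]).

Definition is_component000 : set X -> Prop :=
  is_smallest (fun H => [/\ group_closed (mem H), bounded_index K H &
                            Aut_invariant C (iX @` H)]).

End Components.

(* Main.v *)
From Stdlib Require List.
Require Import Defs.
From HB Require Import structures.
From mathcomp Require Import all_boot all_algebra.
From mathcomp Require Import ring_quotient.
From mathcomp Require Import all_classical.

Set Implicit Arguments.
Unset Strict Implicit.
Unset Printing Implicit Defensive.

Import GRing.Theory.

Local Open Scope classical_set_scope.
Local Open Scope ring_scope.

(** Write [E] for the extension of [Gs] by [As], [jA] and [jG] for the embeddings
of [A] and [G] into [As] and [Gs], and identify [A0] with its image.

Components. An invariant subgroup of bounded index cannot separate two elements
that have the same type over the small model [M] ([same_type_related]). Hence an
intersection of such subgroups still has at most as many cosets as there are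
types over [M], which is fewer than [K], and both components of [E] exist
([exists_component000], [exists_component00]).

The obstruction. Let [U] be an invariant subgroup of [As] of bounded index,
stable under [Gs]. As [M] is an elementary submodel, [hs] takes its values in
the image of [coc_image h], so the pairs [(a0 + u, g)] with [a0] in [A0] and [u]
in [U] form an invariant subgroup [sum_ext] of bounded index of [E]. If a
subgroup [H] of it projects onto [Gs], choosing a point of [H] over each element
of [G] splits [h] modulo the group [P] of those [a] in [A0] for which some
[(a + u, 1)] lies in [H] ([split_modulo_obstruction]).

The components differ. Suppose that they are equal to the same [H]; then [H] is
type-definable and contained in [sum_ext] for [U = A1], and it projects onto
[Gs] by the hypothesis on [Gs]. Here [P = 0], which contradicts that [h] does
not split. Indeed the kernel of [H] over [Gs] is type-definable, hence compact,
while it maps onto the group [P], which embeds in some [Z^r]. By compactness the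
2-adic limit of the partial sums that converge to [a / 3] is
attained for every [a] in [P], so [P = 3 P] ([obstruction_div3]); and in a
finitely generated torsion-free group only 0 is divisible by all powers of 3
([generated_residual]).

The second part. Let [H] be a type-definable subgroup of bounded index, with
kernel [T] over [Gs]. Apply the construction to [U = A1 & T] and to the subgroup
[H & sum_ext], which is only invariant, but projects onto [Gs] since the
invariant component of [Gs] is everything. As [h] does not split modulo a proper
subgroup of [A0], [P = A0], and as [U] is contained in [T] this says that [T]
contains [A0]. By hypothesis [T] is then everything, and so is [H]
([component00_full]). *)

(** * Comparison of cardinals *)

Definition embeds (T U : Type) : Prop := exists f : T -> U, injective f.

Lemma embeds_trans T U V : embeds T U -> embeds U V -> embeds T V.
Proof. by move=> [f fI] [g gI]; exists (g \o f); apply: inj_comp. Qed.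

Lemma embeds_prod T U T' U' : embeds T T' -> embeds U U' ->
  embeds (T * U) (T' * U').
Proof.
move=> [f fI] [g gI]; exists (fun x => (f x.1, g x.2)).
by move=> [x y] [x' y'] /= [/fI -> /gI ->].
Qed.

Lemma chain_pair T (F : set (set T)) X Y a b :
  total_on F subset -> F X -> F Y -> X a -> Y b ->
  exists2 Z, F Z & Z a /\ Z b.
Proof.
move=> Ftot FX FY Xa Yb.
have [XY|YX] := Ftot _ _ FX FY; first by exists Y => //; split=> //; exact: XY.
by exists X => //; split=> //; exact: YX.
Qed.

Lemma embeds_total T U : embeds T U \/ embeds U T.
Proof.
pose P (R : set (T * U)) :=
  (forall x y y', R (x, y) -> R (x, y') -> y = y') /\
  (forall x x' y, R (x, y) -> R (x', y) -> x = x').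
have [F FP Ftot|R [[Rfun Rinj] Rmax]] := @Zorn_bigcup _ P.
  split=> [x y y'|x x' y] [X FX Xx] [Y FY Yx];
  have [Z FZ [Za Zb]] := chain_pair Ftot FX FY Xx Yx.
    by have [+ _] := FP _ FZ; apply; eauto.
  by have [_ +] := FP _ FZ; apply; eauto.
have [dom|/existsNP[x0 Nx0]] := pselect (forall x, exists y, R (x, y)).
  have [f fR] := choice dom; left; exists f => x x' fxx'.
  by apply: (Rinj _ _ (f x)); [exact: fR|rewrite fxx'; exact: fR].
have [ran|/existsNP[y0 Ny0]] := pselect (forall y, exists x, R (x, y)).
  have [f fR] := choice ran; right; exists f => x x' fxx'.
  by apply: (Rfun (f x)); [exact: fR|rewrite fxx'; exact: fR].
exfalso; apply: (Rmax (R `|` [set (x0, y0)])).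
  split; last first.
    by move=> sub; apply: Nx0; exists y0; apply: sub; right.
  by move=> z Rz; left.
split=> [x y y'|x x' y] [Rx|[? ?]] [Ry|[? ?]]; subst => //.
- exact: Rfun Rx Ry.
- by case: Nx0; exists y.
- by case: Nx0; exists y'.
- exact: Rinj Rx Ry.
- by case: Ny0; exists x.
- by case: Ny0; exists x'.
Qed.

(** Hessenberg's theorem. A maximal set [X] of the type that carries an
injection of [X * X] into [X] has the cardinality of the whole type: if there
were room for a copy [k X] of [X] outside of [X], the injection would extend to
[X] union [k X], the three new quadrants being sent into [k X]. *)
Lemma embeds_square T : embeds nat T -> embeds (T * T) T.
Proof.
move=> [i iI].
pose dom (R : set ((T * T) * T)) := [set x | exists y, R (x, x, y)].
pose good (R : set ((T * T) * T)) :=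
  [/\ forall p y y', R (p, y) -> R (p, y') -> y = y',
      forall p p' y, R (p, y) -> R (p', y) -> p = p',
      forall a b c, R (a, b, c) -> [/\ dom R a, dom R b & dom R c] &
      forall a b, dom R a -> dom R b -> exists c, R (a, b, c)].
pose R0 : set ((T * T) * T) :=
  [set z | exists a b, z = (i a, i b, i (pickle (a, b)))].
have dom0 a : dom R0 (i a) by exists (i (pickle (a, a))), a, a.
have pickI : injective (pickle : nat * nat -> nat) by exact: pcan_inj pickleK.
have good0 : good R0.
  split.
  - move=> p y y' [a [b [-> ->]]] [a' [b' [/iI aa' /iI bb' ->]]].
    by rewrite aa' bb'.
  - move=> p p' y [a [b [-> ->]]] [a' [b' [-> /iI/pickI[-> ->]]]] //.
  - by move=> a b c [a' [b' [-> -> ->]]]; split; apply: dom0.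
  - move=> a b [_ [a' [_ [-> _ _]]]] [_ [b' [_ [-> _ _]]]].
    by exists (i (pickle (a', b'))), a', b'.
have [F FP Ftot|R [RP Rmax]] := @Zorn_bigcup _ [set R | good (R `|` R0)].
  rewrite /=; have [->|/set0P[X0 FX0]] := eqVneq F set0.
    by rewrite bigcup_set0 set0U.
  set F' : set (set ((T * T) * T)) := [set X `|` R0 | X in F].
  have F'P X : F' X -> good X by move=> [Y FY <-]; exact: FP.
  have F'tot : total_on F' subset.
    move=> _ _ [X FX <-] [Y FY <-].
    by have [s|s] := Ftot _ _ FX FY; [left|right]; exact: setSU.
  have -> : \bigcup_(X in F) X `|` R0 = \bigcup_(X in F') X.
    apply/seteqP; split=> z.
      move=> [[X FX Xz]|R0z]; first by exists (X `|` R0); [exists X|left].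
      by exists (X0 `|` R0); [exists X0|right].
    by move=> [_ [X FX <-] [Xz|R0z]]; [left; exists X|right].
  have up X : F' X -> dom X `<=` dom (\bigcup_(X in F') X).
    by move=> FX x [y xy]; exists y, X.
  split.
  - move=> p y y' [X FX Xz] [Y FY Yz].
    have [Z FZ [Za Zb]] := chain_pair F'tot FX FY Xz Yz.
    by have [+ _ _ _] := F'P _ FZ; apply; eauto.
  - move=> p p' y [X FX Xz] [Y FY Yz].
    have [Z FZ [Za Zb]] := chain_pair F'tot FX FY Xz Yz.
    by have [_ + _ _] := F'P _ FZ; apply; eauto.
  - move=> a b c [X FX Xz]; have [_ _ + _] := F'P _ FX.
    by move=> /(_ _ _ _ Xz)[? ? ?]; split; apply: (up X).
  - move=> a b [y [X FX Xz]] [y' [Y FY Yz]].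
    have [Z FZ [Za Zb]] := chain_pair F'tot FX FY Xz Yz.
    have [_ _ _ /(_ a b)[||c Zc]] := F'P _ FZ; first by exists y.
      by exists y'.
    by exists c, Z.
rewrite /= in RP.
set S := R `|` R0 in RP.
have [Sfun Sinj Sdom Stot] := RP.
pose X := dom S.
have iX n : X (i n) by have [y ?] := dom0 n; exists y; right.
pose XT := {x : T | X x}.
have XTI (x y : XT) : sval x = sval y -> x = y.
  by case: x y => [x Xx] [y Xy] /= xy; subst; congr exist;
    exact: Prop_irrelevance.
have sq : embeds (XT * XT) XT.
  have /choice[f fP] (p : XT * XT) : exists c : XT, S (sval p.1, sval p.2, sval
    c).
    have [c Sc] := Stot _ _ (svalP p.1) (svalP p.2).
    by have [_ _ Xc] := Sdom _ _ _ Sc; exists (exist _ c Xc).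
  exists f => p q fpq; have := fP p; rewrite fpq => /Sinj/(_ (fP q)) [].
  by case: p q {fpq} => [x y] [x' y'] /= /XTI -> /XTI ->.
have boolX : embeds (bool * XT) XT.
  apply: embeds_trans sq; apply: embeds_prod; last by exists id.
  exists (fun b : bool => exist _ (i b) (iX b) : XT).
  by move=> [] [] // [/iI].
have [[k kI]|YX] := embeds_total XT {x : T | ~ X x}; last first.
  (* The complement of [X] embeds in [X], so [T] embeds in two copies of [X]. *)
  have TX : embeds T XT.
    have [g gI] := YX; apply: embeds_trans boolX.
    exists (fun x => if pselect (X x) is left Xx then (true, exist _ x Xx)
      else if pselect (~ X x) is left Nx then (false, g (exist _ x Nx))
      else (true, exist _ (i 0%N) (iX 0%N))).
    move=> x y.
    case: (pselect (X x)) => Xx; case: (pselect (X y)) => Xy.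
    - by move=> [].
    - by case: pselect => // Ny; case: pselect => //; move=> ? [] //.
    - by case: pselect => // Ny; case: pselect => //; move=> ? [] //.
    - by do 2 case: pselect => // ?; move=> [/gI []].
  apply: embeds_trans (embeds_prod TX TX) _; apply: embeds_trans sq _.
  by exists sval; exact: XTI.
have [phi phiI] : embeds ((bool * XT) * (bool * XT)) XT.
  exact: embeds_trans (embeds_prod boolX boolX) sq.
(* [d] enumerates [X] union [k X], and [R1] is the extension to the three new
   quadrants. *)
pose d (u : bool * XT) : T := if u.1 then sval (k u.2) else sval u.2.
have kN x : ~ X (sval (k x)) := svalP (k x).
have kI' x y : sval (k x) = sval (k y) -> x = y.
  move=> kxy; apply: kI; move: kxy; case: (k x) (k y) => [a Xa] [b Xb] /= ab.
  by subst; congr exist; exact: Prop_irrelevance.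
have dI : injective d.
  move=> [[] x] [[] y]; rewrite /d /=.
  - by move=> /kI' ->.
  - by move=> xy; case: (kN x); rewrite xy; exact: svalP.
  - by move=> xy; case: (kN y); rewrite -xy; exact: svalP.
  - by move=> /XTI ->.
have dX u : X (d u) -> u.1 = false.
  by case: u => [[] x] //= /kN.
pose R1 : set ((T * T) * T) :=
  [set z | exists u v, u.1 || v.1 /\ z = (d u, d v, sval (k (phi (u, v))))].
have cross p c c' : S (p, c) -> R1 (p, c') -> False.
  case: p => a b /Sdom[Xa Xb _] [u [v [uv [au bv _]]]].
  by move: uv; rewrite (dX u) -?au// (dX v) -?bv.
have domd u : dom (S `|` R1) (d u).
  case: u => [[] x].
    by exists (sval (k (phi ((true, x), (true, x))))); right;
      exists (true, x), (true, x).
  by have [y ?] : X (sval x) := svalP x; exists y; left.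
have domP a : dom (S `|` R1) a -> exists u, a = d u.
  move=> [y [Sa|[u [_ [_ [-> _ _]]]]]]; last by exists u.
  have Xa : X a by exists y.
  by exists (false, exist _ a Xa).
exfalso; apply: (Rmax (R `|` R1)).
  split=> [z Rz|sub]; first by left.
  pose u0 := (true, exist _ _ (iX 0%N) : XT).
  have R1u : R1 (d u0, d u0, sval (k (phi (u0, u0)))) by exists u0, u0.
  have Su : S (d u0, d u0, sval (k (phi (u0, u0)))) by left; apply: sub; right.
  exact: cross Su R1u.
rewrite /= -setUA (setUC R1) setUA -/S; split.
- move=> p y y' [Sp|Rp] [Sp'|Rp'].
  + exact: Sfun Sp Sp'.
  + by case: (cross _ _ _ Sp Rp').
  + by case: (cross _ _ _ Sp' Rp).
  + move: Rp Rp' => [u [v [_ [-> ->]]]] [u' [v' [_ [/dI -> /dI -> ->]]]] //.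
- move=> p p' y [Sp|Rp] [Sp'|Rp'].
  + exact: Sinj Sp Sp'.
  + move: Rp' Sp => [u [v [_ [-> ->]]]]; case: p => a b /Sdom[_ _ Xk].
    by case: (kN _ Xk).
  + move: Rp Sp' => [u [v [_ [-> ->]]]]; case: p' => a b /Sdom[_ _ Xk].
    by case: (kN _ Xk).
  + by move: Rp Rp' => [u [v [_ [-> ->]]]] [u' [v' [_ [-> /kI'/phiI[-> ->]]]]].
- move=> a b c [Sz|[u [v [uv [-> -> ->]]]]]; last first.
    by split=> //; exact: (domd (true, _)).
  have up x : X x -> dom (S `|` R1) x by move=> [y ?]; exists y; left.
  by have [? ? ?] := Sdom _ _ _ Sz; split; apply: up.
- move=> a b /domP[u ->] /domP[v ->].
  have [uv|] := boolP (u.1 || v.1).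
    by exists (sval (k (phi (u, v)))); right; exists u, v.
  case: u v => [[] x] [[] y] //= _.
  by have [c Sc] := Stot _ _ (svalP x) (svalP y); exists c; left.
Qed.

(** * Small sets and the number of formulas *)

Lemma smallP (K T : Type) (X : set T) :
  small K X <-> ~ exists2 f : K -> T, injective f & forall k, X (f k).
Proof.
split=> [/negP KX [f fI fX]|KX].
  pose g (k : [set: K]) : X := SigSub (mem_set (fX (val k))).
  by apply/KX/card_leP/injfunPex; exists g => // x y _ _ [/fI/val_inj].
apply/negP => /card_leP/injfunPex[f _ fI]; apply: KX.
exists (fun k => val (f (SigSub (mem_set (I : [set: K] k))))).
  by move=> x y /val_inj /fI; rewrite !in_setT => /(_ isT isT)[].
by move=> k; apply: set_mem; exact: valP.
Qed.

Section Small.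
Variables (K : Type).
Hypothesis Kinf : embeds nat K.

Lemma small_inj T U (X : set T) (Y : set U) (f : T -> U) :
  (forall x, X x -> Y (f x)) ->
  (forall x y, X x -> X y -> f x = f y -> x = y) ->
  small K Y -> small K X.
Proof.
move=> fXY fI /smallP KY; apply/smallP => -[g gI gX]; apply: KY.
by exists (f \o g) => [x y /fI-/(_ (gX _) (gX _))/gI|k]; last exact: fXY.
Qed.

Lemma small_sub T (X Y : set T) : X `<=` Y -> small K Y -> small K X.
Proof. by move=> XY; exact: (@small_inj _ _ _ _ id XY). Qed.

Lemma small_image T U (X : set T) (f : T -> U) : small K X -> small K (f @` X).
Proof.
move=> /smallP KX; apply/smallP => -[g gI gX]; apply: KX.
have [r rP] : {r : K -> T & forall k, X (r k) /\ f (r k) = g k}.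
  by apply: (@choice _ _ (fun k x => X x /\ f x = g k)) => k;
    have [x Xx fx] := gX k; exists x.
exists r => [x y rxy|k]; last by have [] := rP k.
by apply: gI; rewrite -(rP x).2 rxy (rP y).2.
Qed.

Lemma small_setU T (X Y : set T) : small K X -> small K Y -> small K (X `|` Y).
Proof.
move=> /smallP KX /smallP KY; apply/smallP => -[f fI fXY].
have [p pI] := embeds_square Kinf.
(* Koenig: identify [K] with [K * K]; either a column is sent into [X], or each
   column has a point that is sent into [Y]. *)
have [[k kX]|nX] := pselect (exists k, forall k', X (f (p (k, k')))).
  by apply: KX; exists (fun k' => f (p (k, k'))) => // x y /fI/pI [].
have [g gP] : {g : K -> K & forall k, ~ X (f (p (k, g k)))}.
  by apply: (@choice _ _ (fun k x => ~ X (f (p (k, x))))) => k;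
    apply/existsNP => kX; apply: nX; exists k.
apply: KY; exists (fun k => f (p (k, g k))) => [x y /fI/pI []//|k].
by have [/gP|] := fXY (p (k, g k)).
Qed.

Lemma small_set0 T : small K (set0 : set T).
Proof. by have [f _] := Kinf; apply/smallP => -[g _ /(_ (f 0%N))]. Qed.

Lemma small_set1 T (x : T) : small K [set x].
Proof.
have [f fI] := Kinf; apply/smallP => -[g gI gX].
suff /fI : f 0%N = f 1%N by [].
by apply: gI; rewrite [LHS]gX [RHS]gX.
Qed.

Lemma small_bigcup T (I : finType) (F : I -> set T) :
  (forall i, small K (F i)) -> small K (\bigcup_i F i).
Proof.
move=> FK; suff /(_ (enum I)) : forall s : seq I,
    small K [set x | exists2 i, i \in s & F i x].
  by apply: small_sub => x [i _ Fix]; exists i => //; rewrite mem_enum.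
elim=> [|i s IHs]; first by apply: small_sub (@small_set0 T) => x [].
apply: small_sub (small_setU (FK i) IHs) => x [j].
by rewrite inE => /orP[/eqP ->|js] Fx; [left|right; exists j].
Qed.

Lemma small_range T (W : finType) (u : W -> T) : small K (range u).
Proof.
have K1 i := small_set1 (u i).
by apply: small_sub (small_bigcup K1) => _ [i _ <-]; exists i.
Qed.

End Small.

Section CountFormulas.
Variables (L : signature) (T : Type).
Hypotheses (Tinf : embeds nat T) (LT : embeds (fun_sym L + rel_sym L) T).

(** A pairing function on [T] codes terms and formulas by elements of [T], by
recursion; a bound variable being a new element [None] of the type of
variables, the coding of variables is shifted at each quantifier. *)
Lemma embeds_formula V : embeds V T -> embeds (formula L V) T.
Proof.
have [n nI] := Tinf; have [l lI] := LT.
have [pr prI] := embeds_square Tinf.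
have prE a b c d : pr (a, b) = pr (c, d) -> a = c /\ b = d by move=> /prI [].
pose code_seq := foldr (fun x y => pr (x, y)) (n 0%N).
have code_tuple k (f g : 'I_k -> T) :
    code_seq [seq f i | i <- enum 'I_k] = code_seq [seq g i | i <- enum 'I_k] ->
    f =1 g.
  move=> fg i; have := mem_enum 'I_k i; rewrite inE => /esym.
  by elim: (enum 'I_k) fg => //= j s IHs /prE[fgj /IHs fgs];
     rewrite inE => /esym/orP[/eqP->|/esym].
pose ct V (c : V -> T) := fix ct (t : term L V) : T :=
  match t with
  | Var x => pr (n 0%N, c x)
  | App f u => pr (n 1%N, pr (l (inl f),
                 code_seq [seq ct (u i) | i <- enum 'I_(fun_ar f)]))
  end.
have ctI W (c : W -> T) : injective c -> injective (ct W c).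
  move=> cI; elim=> [x|f u IHu] [y|g v] /=.
  - by move=> /prE[_ /cI ->].
  - by move=> /prE[/nI].
  - by move=> /prE[/nI].
  - move=> /prE[_ /prE[/lI[fg]]]; move: fg v => <- v /code_tuple uv.
    by congr App; apply: funext => i; apply: IHu; exact: uv.
pose shift W (c : W -> T) (o : option W) : T :=
  if o is Some x then pr (n 1%N, c x) else pr (n 0%N, n 0%N).
have shiftI W (c : W -> T) : injective c -> injective (shift W c).
  move=> cI [x|] [y|] //= /prE[]; first by move=> _ /cI ->.
    by move=> /nI.
  by move=> /nI.
pose cf := fix cf W (p : formula L W) (c : W -> T) {struct p} : T :=
  match p with
  | Falsum => pr (n 0%N, n 0%N)
  | Equal s t => pr (n 1%N, pr (ct _ c s, ct _ c t))
  | Rel r u => pr (n 2%N, pr (l (inr r),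
                 code_seq [seq ct _ c (u i) | i <- enum 'I_(rel_ar r)]))
  | Imp p q => pr (n 3%N, pr (cf _ p c, cf _ q c))
  | All p => pr (n 4%N, cf _ p (shift _ c))
  end.
move=> [c cI]; exists (fun p => cf V p c) => p q; move: p c cI q.
elim=> {V} [V|V s t|V r u|V p IHp q IHq|V p IHp] c cI [|s' t'|r' u'|p' q'|p']
  /=;
  try by move=> /prE[/nI].
- by move=> /prE[_ /prE[/(ctI _ _ cI) -> /(ctI _ _ cI) ->]].
- move=> /prE[_ /prE[/lI[rr]]]; move: rr u' => <- u' /code_tuple uv.
  by congr Rel; apply: funext => i; apply: (ctI _ _ cI); exact: uv.
- by move=> /prE[_ /prE[/(IHp _ cI) -> /(IHq _ cI) ->]].
- by move=> /prE[_ /(IHp _ (shiftI _ _ cI)) ->].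
Qed.

End CountFormulas.

(** * Definable and type-definable sets *)

Lemma finite_listP T (A : set T) :
  finite_set A -> exists s : seq T, forall x, A x <-> List.In x s.
Proof.
move=> finA; have /finite_seqP[s As] : finite_set (A : set {classic T}) by [].
exists s => x; have -> : A x <-> ((x : {classic T}) \in s).
  by rewrite As.
elim: s {As} => //= y s <-; rewrite inE; split.
  by move=> /predU1P[->|]; [left|right].
by move=> [->|xs]; rewrite ?eqxx// xs orbT.
Qed.

Definition sum_map V W V' W' (f : V' -> V) (g : W' ->
  W) (u : V' + W') : V + W :=
  match u with inl x => inl (f x) | inr y => inr (g y) end.

Lemma join_comp T V W V' W' (f : V' -> V) (g : W' -> W) (x : V ->
  T) (y : W -> T) :
  join (x \o f) (y \o g) = join x y \o sum_map f g.
Proof. by apply: funext => -[]. Qed.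

Lemma comp_join T U V W (s : T -> U) (x : V -> T) (y : W -> T) :
  s \o join x y = join (s \o x) (s \o y).
Proof. by apply: funext => -[]. Qed.

Section Formulas.
Variable L : signature.

Fixpoint ren_term V W (f : V -> W) (t : term L V) : term L W :=
  match t with
  | Var x => Var L (f x)
  | App g u => App (fun i => ren_term f (u i))
  end.

Fixpoint ren V W (f : V -> W) (p : formula L V) : formula L W :=
  match p with
  | Falsum => Falsum L W
  | Equal s t => Equal (ren_term f s) (ren_term f t)
  | Rel r u => Rel (fun i => ren_term f (u i))
  | Imp p q => Imp (ren f p) (ren f q)
  | All p => All (ren (option_map f) p)
  end.

Lemma eval_ren (M : structure L) V W (f : V -> W) (w : W -> M) (t : term L V) :
  eval w (ren_term f t) = eval (w \o f) t.
Proof.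
by elim: t => //= g u IHu; congr fun_int; apply: funext => i; exact: IHu.
Qed.

Lemma sat_ren (M : structure L) V W (f : V -> W) (p : formula L V) (w : W ->
  M) :
  sat (ren f p) w <-> sat p (w \o f).
Proof.
elim: p W f w => {V} [V|V s t|V r u|V p IHp q IHq|V p IHp] W f w //=.
- by rewrite !eval_ren.
- suff -> : (fun i => eval w (ren_term f (u i))) =
            (fun i => eval (w \o f) (u i)) by [].
  by apply: funext => i; exact: eval_ren.
- by rewrite IHp IHq.
- have E x : extend x w \o option_map f = extend x (w \o f).
    by apply: funext => -[].
  by split=> H x; [rewrite -E -IHp|rewrite IHp E].
Qed.

Definition Not V (p : formula L V) := Imp p (Falsum L V).
Definition And V (p q : formula L V) := Not (Imp p (Not q)).
Definition Ex V (p : formula L (option V)) := Not (All (Not p)).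

Lemma sat_Not (M : structure L) V (p : formula L V) (v : V -> M) :
  sat (Not p) v <-> ~ sat p v.
Proof. by []. Qed.

Lemma sat_And (M : structure L) V (p q : formula L V) (v : V -> M) :
  sat (And p q) v <-> sat p v /\ sat q v.
Proof.
split=> /= [H|[Hp Hq] H]; last exact: H.
by split; apply: contrapT => N; apply: H => Hp Hq; exact: N.
Qed.

Lemma sat_Ex (M : structure L) V (p : formula L (option V)) (v : V -> M) :
  sat (Ex p) v <-> exists x, sat p (extend x v).
Proof.
split=> /= [H|[x Hx] H]; last exact: H Hx.
by apply: contrapT => N; apply: H => x px; apply: N; exists x.
Qed.

Lemma finite_conj V (S : set (formula L V)) : finite_set S ->
  exists q : formula L V, forall (M : structure L) (v : V -> M),
    sat q v <-> forall p, S p -> sat p v.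
Proof.
move=> /finite_listP[s Ss].
suff [q qP] : exists q : formula L V, forall (M : structure L) (v : V -> M),
    sat q v <-> forall p, List.In p s -> sat p v.
  by exists q => M v; rewrite qP; split=> H p /Ss /H.
elim: s {Ss} => [|p s [q qP]].
  by exists (Not (Falsum L V)) => M v; split=> [_ p []|_ []].
exists (And p q) => M v; rewrite sat_And qP; split.
  by move=> [pv sv] r /= [<-//|/sv].
by move=> H; split=> [|r rs]; apply: H; [left|right].
Qed.

(** The quantified variables are counted uniformly in the model, so that the
resulting formula can be transferred along an elementary embedding. *)
Lemma finite_exists (W : finType) V (p : formula L (V + W)) :
  exists q : formula L V, forall (M : structure L) (v : V -> M),
    sat q v <-> exists w : W -> M, sat p (join v w).
Proof.
suff H k : forall V (p : formula L (V + 'I_k)),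
    exists q : formula L V, forall (M : structure L) (v : V -> M),
    sat q v <-> exists w : 'I_k -> M, sat p (join v w).
  have [q qP] := H _ _ (ren (sum_map id enum_rank) p).
  exists q => M v; rewrite qP; split=> -[w].
    by rewrite sat_ren -join_comp; exists (w \o enum_rank).
  move=> vw; exists (w \o enum_val); rewrite sat_ren -join_comp.
  suff -> : (w \o enum_val) \o enum_rank = w by [].
  by apply: funext => x /=; rewrite enum_rankK.
elim: k => [|k IHk] {p}V p.
  pose f (x : V + 'I_0) : V :=
    match x with inl v => v | inr i => False_rect V (notF (ltn_ord i)) end.
  exists (ren f p) => M v.
  have E w : v \o f = join v w by apply: funext => -[//|[]].
  rewrite sat_ren; split=> [H|[w]]; last by rewrite (E w).
  have w : 'I_0 -> M by case.
  by exists w; rewrite -E.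
pose f (x : V + 'I_k.+1) : option V + 'I_k :=
  match x with
  | inl v => inl (Some v)
  | inr i => if unlift ord0 i is Some j then inr j else inl None
  end.
have [q qP] := IHk _ (ren f p).
have E (M : structure L) (v : V -> M) (w : 'I_k.+1 -> M) :
    join (extend (w ord0) v) (w \o lift ord0) \o f = join v w.
  by apply: funext => -[//|i] /=; case: unliftP => [j ->|->].
exists (Ex q) => M v; rewrite sat_Ex; split.
  move=> [x /qP[w]]; rewrite sat_ren => H.
  exists (fun i => if unlift ord0 i is Some j then w j else x).
  rewrite -E unlift_none; move: H; congr (sat p (_ \o f)).
  congr join; apply: funext => i /=.
  by rewrite liftK.
move=> [w H]; exists (w ord0); apply/qP; exists (w \o lift ord0).
by rewrite sat_ren E.
Qed.

Lemma sat_automorphism (M : structure L) (s : M -> M) : automorphism s ->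
  forall V (p : formula L V) (v : V -> M), sat p v <-> sat p (s \o v).
Proof.
move=> [[r sr rs] sf srel].
have ev V (v : V -> M) t : s (eval v t) = eval (s \o v) t.
  elim: t => //= g u IHu; rewrite sf; congr fun_int.
  by apply: funext => i; exact: IHu.
move=> V; elim=> {V} [V|V t u|V R u|V p IHp q IHq|V p IHp] v //=.
- by rewrite -!ev; split=> [->//|/(can_inj sr)].
- rewrite srel; suff -> : s \o (fun i => eval v (u i)) =
    (fun i => eval (s \o v) (u i)) by [].
  by apply: funext => i; exact: ev.
- by rewrite -IHp -IHq.
- have E x : s \o extend x v = extend (s x) (s \o v) by apply: funext => -[].
  split=> H x; last by rewrite IHp E.
  by rewrite -[x]rs -E -IHp.
Qed.

End Formulas.

Section TypeDefinable.
Variables (L : signature) (N : structure L).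
Implicit Types (C : set N) (V W : Type).

Definition same_type C V (x y : V -> N) : Prop :=
  forall p : formula L (V + C), holds p x <-> holds p y.

Lemma holds_ren C V W (f : V -> W) (p : formula L (V + C)) (w : W -> N) :
  holds (ren (sum_map f id) p) w <-> holds p (w \o f).
Proof. by rewrite /holds sat_ren -join_comp. Qed.

Definition incl C C' (CC' : C `<=` C') (c : C) : C' :=
  SigSub (mem_set (CC' _ (set_valP c))).

Lemma holds_incl C C' (CC' : C `<=` C') V (p : formula L (V + C)) (v : V -> N) :
  holds (ren (sum_map id (incl CC')) p) v <-> holds p v.
Proof. by rewrite /holds sat_ren -join_comp. Qed.

(** All formulas over [C] that hold on the set may serve to define it, so that no
set of formulas has to be chosen in the constructions below. *)
Lemma type_definableP C V (X : set (V -> N)) : type_definable C X <->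
  forall x, (forall p : formula L (V + C),
    (forall y, X y -> holds p y) -> holds p x) -> X x.
Proof.
split=> [[S ->] x H p Sp|H]; first by apply: H => y; exact.
exists [set p | forall y, X y -> holds p y]; apply/seteqP; split=> x Xx /=.
  by move=> p; exact.
exact: H.
Qed.

Lemma type_definable_formula C V (p : formula L (V + C)) :
  type_definable C [set x | holds p x].
Proof. by apply/type_definableP => x; exact. Qed.

Lemma type_definable_bigcap C V I (D : set I) (F : I -> set (V -> N)) :
  (forall i, D i -> type_definable C (F i)) ->
  type_definable C (\bigcap_(i in D) F i).
Proof.
move=> FC; apply/type_definableP => x H i Di.
move/type_definableP: (FC i Di); apply=> p Fp.
by apply: H => y Fy; apply: Fp; exact: Fy.
Qed.

Lemma type_definableI C V (X Y : set (V -> N)) :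
  type_definable C X -> type_definable C Y -> type_definable C (X `&` Y).
Proof.
move=> XC YC; rewrite -bigcap2E; apply: type_definable_bigcap => -[|[|i]] //= _.
by apply/type_definableP.
Qed.

Lemma type_definable_sub C C' V (X : set (V -> N)) : C `<=` C' ->
  type_definable C X -> type_definable C' X.
Proof.
move=> CC' /type_definableP XC; apply/type_definableP => x H; apply: XC => p Xp.
by apply/(holds_incl CC'); apply: H => y Xy; apply/holds_incl; exact: Xp.
Qed.

Lemma type_definable_preimage C V W (f : V -> W) (X : set (V -> N)) :
  type_definable C X -> type_definable C [set w : W -> N | X (w \o f)].
Proof.
move=> /type_definableP XC; apply/type_definableP => x H; apply: XC => p Xp.
by apply/holds_ren; apply: H => y Xy; apply/holds_ren; exact: Xp.
Qed.

Lemma type_definable_const C V (c : V -> N) : (forall i, C (c i)) ->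
  type_definable C [set c].
Proof.
move=> Cc; apply/type_definableP => x H; apply: funext => i.
apply: (H (Equal (Var L (inl i)) (Var L (inr (SigSub (mem_set (Cc i))))))).
by move=> _ ->.
Qed.

Lemma type_definable_Aut_invariant C V (X : set (V -> N)) :
  type_definable C X -> Aut_invariant C X.
Proof.
move=> /type_definableP XC s sA sC x Xx; apply: XC => p Xp.
have := Xp _ Xx; rewrite /holds (sat_automorphism sA) comp_join.
suff -> : s \o (fun c : C => val c) = (fun c : C => val c) by [].
by apply: funext => c /=; apply: sC; exact: set_valP.
Qed.

Lemma same_type_comp C V W (f : V -> W) (x y : W -> N) :
  same_type C x y -> same_type C (x \o f) (y \o f).
Proof. by move=> xy p; rewrite -(holds_ren f p x) -(holds_ren f p y). Qed.

Lemma same_type_sym C V (x y : V -> N) : same_type C x y -> same_type C y x.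
Proof. by move=> xy p; rewrite xy. Qed.

End TypeDefinable.

Section Saturation.
Variables (K : Type) (L : signature) (N : structure L).
Hypotheses (Kinf : embeds nat K) (Nsat : saturated K N)
           (Nhom : strongly_homogeneous K N).
Implicit Types C : set N.

Lemma compactness C (V : finType) I (D : set I) (F : I -> set (V -> N)) :
  small K C -> (forall i, D i -> type_definable C (F i)) ->
  (forall D0, D0 `<=` D -> finite_set D0 -> \bigcap_(i in D0) F i !=set0) ->
  \bigcap_(i in D) F i !=set0.
Proof.
move=> Csm FC fip.
pose S (p : formula L (V + C)) := exists2 i, D i & forall y, F i y -> holds p y.
have [|x Sx] := Nsat Csm (S := S); last first.
  exists x => i Di; move/type_definableP: (FC i Di); apply => p Fp.
  by apply: Sx; exists i.
move=> S0 S0S S0fin.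
have [->|/set0P[p0 S0p0]] := eqVneq S0 set0.
  have [x _] := fip set0 (@sub0set _ _) (@finite_set0 _).
  by exists x.
have [i0 _ _] := S0S _ S0p0.
have [f fP] : {f : formula L (V + C) -> I &
    forall p, S0 p -> D (f p) /\ forall y, F (f p) y -> holds p y}.
  apply: (@choice _ _ (fun p i => S0 p -> D i /\ forall y, F i y -> holds p y)).
  move=> p; have [/S0S[i Di Fi]|] := pselect (S0 p).
    by exists i.
  by exists i0.
have [|x xP] := fip (f @` S0) _ (finite_image _ S0fin).
  by move=> _ [p S0p <-]; have [] := fP _ S0p.
by exists x => p S0p; have [_] := fP _ S0p; apply; apply: xP; exists p.
Qed.

Lemma compactness_decreasing C (V : finType) (F : nat -> set (V -> N)) :
  small K C -> (forall k, type_definable C (F k)) ->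
  (forall k, F k.+1 `<=` F k) -> (forall k, F k !=set0) ->
  exists x, forall k, F k x.
Proof.
move=> Csm FC Fdecr F0.
have Fle k l : (k <= l)%N -> F l `<=` F k.
  elim: l => [|l IHl]; first by rewrite leqn0 => /eqP ->.
  by rewrite leq_eqVlt => /predU1P[->//|/IHl FF]; apply: subset_trans FF.
have [|x xP] := compactness (D := setT) Csm (fun k _ => FC k).
  move=> D0 _ /finite_listP[s sP].
  have [m mP] : exists m, forall k, D0 k -> (k <= m)%N.
    exists (\max_(k <- s) k) => k /sP {sP}.
    elim: s => //= l s IHs; rewrite big_cons leq_max => -[->|/IHs ->].
      by rewrite leqnn.
    by rewrite orbT.
  by have [x Fx] := F0 m; exists x => k /mP/Fle; exact.
by exists x => k; exact: xP.
Qed.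

(** Tuples [x] of the set with [x \o f = y] are sought by compactness. A finite
fragment of this search is an existential formula in [y], which holds on the
image and therefore at every point that no formula separates from it. *)
Lemma type_definable_image C (V W : finType) (f : W -> V) (X : set (V -> N)) :
  small K C -> type_definable C X -> type_definable C [set x \o f | x in X].
Proof.
move=> Csm XC; apply/type_definableP => y Hy.
pose D : set (formula L (V + C)) := [set p | forall x, X x -> holds p x].
pose F (p : formula L (V + C)) :=
  [set x : V -> N | holds p x] `&` [set x : V -> N | x \o f = y].
have C'sm : small K (C `|` range y).
  by apply: small_setU => //; exact: small_range.
have [||x xP] := @compactness (C `|` range y) V _ D F C'sm.
- move=> p _; apply: type_definableI.
    by apply: type_definable_sub (type_definable_formula p); exact: subsetUl.
  apply: (@type_definable_preimage _ _ _ _ _ f [set y]).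
  by apply: type_definable_const => i; right; exists i.
- move=> D0 D0D /finite_conj[q qP].
  pose eqs : set (formula L (W + C + V)) :=
    [set Equal (Var L (inl (inl i))) (Var L (inr (f i))) | i in [set: W]].
  have [r rP] : exists r : formula L (W + C + V), forall (v : _ -> N),
      sat r v <-> forall p, eqs p -> sat p v.
    have [|r rP] := @finite_conj _ _ eqs; last by exists r => v; exact: rP.
    exact/finite_image/finite_finset.
  pose g (u : V + C) : W + C + V :=
    match u with inl v => inr v | inr c => inl (inr c) end.
  have [t tP] := finite_exists (And (ren g q) r).
  have gE (z : W -> N) (x : V -> N) :
      join (join z (fun c : C => val c)) x \o g = join x (fun c : C => val c).
    by apply: funext => -[].
  have tE (z : W -> N) : holds t z <->
      exists2 x, holds q x & x \o f = z.
    rewrite /holds tP; split=> [[x]|[x qx xf]].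
      rewrite sat_And sat_ren gE rP => -[qx eqx]; exists x => //.
      by apply: funext => i; have /esym := eqx _ (ex_intro2 _ _ i I erefl).
    exists x; rewrite sat_And sat_ren gE rP; split=> // _ [i _ <-] /=.
    by rewrite -xf.
  have /Hy/tE[x qx xf] : forall z, [set x \o f | x in X] z -> holds t z.
    move=> _ [x Xx <-]; apply/tE; exists x => //.
    by apply/qP => p /D0D; exact.
  by exists x => p D0p; split=> //=; move/qP: qx; exact.
- exists x; last by have [] := xP (Not (Falsum L _)) (fun _ _ => id).
  by move/type_definableP: XC; apply => p Dp; have [] := xP _ Dp.
Qed.

(** Equality of types makes the map that fixes [C] and sends [u] to [u'] well
defined and elementary; homogeneity extends it. *)
Lemma same_type_automorphism C (W : finType) (u u' : W -> N) :
  small K C -> same_type C u u' ->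
  exists s, [/\ automorphism s, forall c, C c -> s c = c & s \o u = u'].
Proof.
move=> Csm uu'.
pose D := C `|` range u.
have Dsm : small K D by apply: small_setU => //; exact: small_range.
have [g gP] : {g : D ->
  W + C & forall d, join u (fun c : C => val c) (g d) = val d}.
  apply: (@choice _ _
    (fun d x => join u (fun c : C => val c) x = val (d : D))) => d;
      have [Cd|[i _ ud]] := set_valP d.
    by exists (inr (SigSub (mem_set Cd))).
  by exists (inl i).
have gE : (fun d : D => val d) = join u (fun c : C => val c) \o g.
  by apply: funext => d; rewrite -gP.
have [|s sA sP] := Nhom (f := join u' (fun c : C => val c) \o g) Dsm.
  move=> p; rewrite gE -!sat_ren; exact: uu'.
have fix_eq (a b : W + C) : join u (fun c : C =>
  val c) a = join u (fun c : C => val c) b ->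
    join u' (fun c : C => val c) a = join u' (fun c : C => val c) b.
  by move=> ab; apply/(uu' (Equal (Var L a) (Var L b))).
exists s; split=> // [c Cc|].
  have Dc : D c by left.
  have := sP (SigSub (mem_set Dc)) => /= ->.
  exact: (fix_eq _ (inr (SigSub (mem_set Cc))) (gP (SigSub (mem_set Dc)))).
apply: funext => i; have Dc : D (u i) by right; exists i.
have := sP (SigSub (mem_set Dc)) => /= ->.
exact: (fix_eq _ (inl i) (gP (SigSub (mem_set Dc)))).
Qed.

End Saturation.

(** * Coheirs and invariant equivalence relations *)

Section Coheir.
Variables (L : signature) (M N : structure L) (e : M -> N) (K : Type).
Hypothesis (eE : elementary e) (Kinf : embeds nat K) (Nsat : saturated K N)
           (Nhom : strongly_homogeneous K N) (Msm : small K (range e)).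
Local Notation M0 := (range e).

Lemma solution_in_submodel (V : finType) (p : formula L (V + M0)) (x : V -> N) :
  holds p x -> exists m : V -> M, holds p (e \o m).
Proof.
have [g gP] : {g : M0 -> M & forall c, e (g c) = val c}.
  apply: (@choice _ _ (fun (c : M0) m => e m = val c)) => c.
  by have [m _ em] := set_valP c; exists m.
pose f (u : V + M0) : M + V :=
  match u with inl v => inr v | inr c => inl (g c) end.
have [t tP] := finite_exists (ren f p).
have fE (y : V -> N) : holds p y <-> sat (ren f p) (join e y).
  rewrite sat_ren /holds;
    suff -> : join e y \o f = join y (fun c : M0 => val c) by [].
  by apply: funext => -[//|c] /=; rewrite gP.
move=> /fE px; have /(eE t id)/tP[m] : sat t (e \o id) by apply/tP; exists x.
by move=> /eE; rewrite comp_join -fE; exists m.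
Qed.

Section Ultrafilter.
Variables (V : finType) (U : set_system (V -> M)).
Hypothesis UU : UltraFilter U.

(** The element [c] realizes over [C] the coheir that the ultrafilter [U]
defines: the complete global type of the formulas that hold at [U]-almost all
tuples of the small model. *)
Definition realizes (C : set N) (c : V -> N) : Prop :=
  forall p : formula L (V + C), U [set m | holds p (e \o m)] -> holds p c.

Lemma realizesE (C : set N) c (p : formula L (V + C)) : realizes C c ->
  holds p c <-> U [set m | holds p (e \o m)].
Proof.
move=> cU; split=> [pc|]; last exact: cU.
have [//|Up] := in_ultra_setVsetC [set m | holds p (e \o m)] UU.
by case: (cU (Not p) Up).
Qed.

Lemma realizes_sub (C C' : set N) c : C `<=` C' -> realizes C' c ->
  realizes C c.
Proof.
move=> CC' cU p Up; apply/(holds_incl CC')/cU.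
by move: Up; apply: filterS => m /= pm; apply/holds_incl.
Qed.

Lemma realizes_same_type (C : set N) c c' : realizes C c -> realizes C c' ->
  same_type C c c'.
Proof. by move=> cU c'U p; rewrite (realizesE p cU) (realizesE p c'U). Qed.

Lemma exists_realizes (C : set N) : small K C -> exists c, realizes C c.
Proof.
move=> Csm; apply: (Nsat Csm (S := [set p | U [set m | holds p (e \o m)]])).
move=> S0 S0U /finite_listP[s sP].
have : U [set m | forall p, List.In p s -> holds p (e \o m)].
  have {sP} : forall p, List.In p s -> U [set m | holds p (e \o m)].
    by move=> p /sP /S0U.
  elim: s => [|p s IHs] sU.
    by apply: filterS filterT => m _ p [].
  have Us := IHs (fun q qs => sU q (or_intror qs)).
  have Up := sU p (or_introl erefl).
  by apply: filterS (filterI Up Us) => m [/= pm sm] q [<-|/sm].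
by move=> /filter_ex[m sm]; exists (e \o m) => p /sP/sm.
Qed.

(** A coheir is determined by its restriction to the small model: whether it
contains a formula with parameters [d] only depends on the type of [d] over
that model, as all tuples that the ultrafilter sees lie in it. *)
Lemma realizes_join (W : Type) (d d' : W -> N) c c' :
  same_type M0 d d' ->
  realizes (M0 `|` range d) c -> realizes (M0 `|` range d') c' ->
  same_type M0 (join c d) (join c' d').
Proof.
have par (d0 : W -> N) : exists f : V + W + M0 -> V + (M0 `|` range d0 : set N),
    forall x : V -> N, join x (fun c : M0 `|` range d0 : set N => val c) \o f
       = join (join x d0) (fun c : M0 => val c).
  have Dd w : (M0 `|` range d0) (d0 w) by right; exists w.
  exists (fun u => match u with
    | inl (inl v) => inl v
    | inl (inr w) => inr (SigSub (mem_set (Dd w)))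
    | inr c => inr (incl (@subsetUl _ M0 (range d0)) c)
    end).
  by move=> x; apply: funext => -[[]|].
move=> dd' cU c'U p.
have [f fE] := par d; have [f' f'E] := par d'.
have -> : holds p (join c d) <-> holds (ren f p) c by rewrite /holds sat_ren fE.
have -> : holds p (join c' d') <->
  holds (ren f' p) c' by rewrite /holds sat_ren f'E.
rewrite (realizesE _ cU) (realizesE _ c'U).
suff -> : [set m : V -> M | holds (ren f p) (e \o m)] =
          [set m | holds (ren f' p) (e \o m)] by [].
apply/seteqP; suff H m : holds (ren f p) (e \o m) <-> holds (ren f' p) (e \o m).
  by split=> m /H.
rewrite /holds !sat_ren fE f'E.
have M0e v : M0 (e (m v)) by exists (m v).
pose g (u : V + W + M0) : W + M0 := match u with
  | inl (inl v) => inr (SigSub (mem_set (M0e v)))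
  | inl (inr w) => inl w
  | inr c => inr c
  end.
have gE (d0 : W -> N) : join (join (e \o m) d0) (fun c : M0 => val c) =
    join d0 (fun c : M0 => val c) \o g by apply: funext => -[[]|].
by rewrite !gE -!sat_ren; exact: dd'.
Qed.

End Ultrafilter.

Lemma exists_coheir (V : finType) (a : V -> N) :
  exists2 U, UltraFilter U & realizes U M0 a.
Proof.
pose F (A : set (V -> M)) := exists2 p : formula L (V + M0),
  holds p a & forall m, holds p (e \o m) -> A m.
have FF : ProperFilter F.
  apply: Build_ProperFilter_ex.
    by move=> A [p /solution_in_submodel[m pm] pA]; exists m; exact: pA.
  split.
  - by exists (Not (Falsum L _)) => // [] [].
  - move=> A A' [p pa pA] [p' p'a p'A']; exists (And p p').
      by rewrite /holds sat_And.
    by move=> m; rewrite /holds sat_And => -[/pA ? /p'A' ?].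
  - by move=> A A' AA' [p pa pA]; exists p => // m /pA /AA'.
have [U [UU FU]] := ultraFilterLemma FF; exists U => // p Up.
apply: contrapT => pa.
have UNp : U [set m | holds (Not p) (e \o m)] by apply: FU; exists (Not p).
by have [m [/= pm]] := filter_ex (filterI Up UNp); apply.
Qed.

(** Let [c] and [c'] realize the coheir of the common type of [a] and [b], where
[c'] does so over representatives of all classes and over [c]. Then [c] and [c']
have the same type over the representatives, so they lie in the same class; and
all pairs that look like [c', c] over the model are related too. A tuple [d] that
realizes the coheir over both [a] and [b] forms such a pair with each of them. *)
Lemma same_type_related (V : finType) (E : (V -> N) -> (V -> N) -> Prop)
    (I R : set (V -> N)) :
  (forall s, automorphism s -> (forall c, M0 c -> s c = c) ->
     (forall x, I x -> I (s \o x)) /\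
     forall x y, E x y -> E (s \o x) (s \o y)) ->
  (forall x y, E x y -> E y x) -> (forall x y z, E x y -> E y z -> E x z) ->
  small K R -> (forall x, I x -> exists2 r, R r & E x r) ->
  forall a b, I a -> same_type M0 a b -> E a b.
Proof.
move=> inv Esym Etr Rsm IR a b Ia ab.
have [U UU aU] := exists_coheir a.
(* The model together with the coordinates of the representatives. *)
pose D := M0 `|` \bigcup_i [set r i | r in R].
have Dsm : small K D.
  by apply: small_setU => //; apply: small_bigcup => // i; exact: small_image.
have [c cU] := exists_realizes UU Dsm.
have [c' c'U] := exists_realizes UU (small_setU Kinf Dsm (small_range Kinf c)).
have ac : same_type M0 a c.
  by apply: realizes_same_type aU _; apply: realizes_sub cU; exact: subsetUl.
have Ic : I c.
  have [s [sA sM0 <-]] := same_type_automorphism Kinf Nhom Msm ac.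
  by have [+ _] := inv s sA sM0; apply.
have [r Rr Ecr] := IR c Ic.
have Ec'c : E c' c.
  have [|s [sA sD sc]] := @same_type_automorphism _ _ _ Kinf Nhom D V c c' Dsm.
    by apply: realizes_same_type cU _; apply: realizes_sub c'U; exact: subsetUl.
  have [|_ /(_ _ _ Ecr)] := inv s sA; first by move=> x M0x; apply: sD; left.
  rewrite sc; suff -> : s \o r = r by move=> Ec'r; apply: Etr Ec'r _;
    exact: Esym.
  by apply: funext => i; apply: sD; right; exists i => //; exists r.
have [d dU] := exists_realizes UU
  (small_setU Kinf (small_setU Kinf Msm (small_range Kinf a)) (small_range Kinf
    b)).
have Ed x : same_type M0 x c -> realizes U (M0 `|` range x) d -> E d x.
  move=> xc dxU.
  have [|s [sA sM0 sdx]] := same_type_automorphism (u := join c' c)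
    (u' := join d x) Kinf Nhom Msm.
    apply: (realizes_join UU _ _ dxU); first exact: same_type_sym.
    by apply: realizes_sub c'U; exact/setSU/subsetUl.
  have [_ /(_ _ _ Ec'c)] := inv s sA sM0.
  have -> : s \o c' = d by apply: funext => i; have := congr1 (@^~ (inl i)) sdx.
  by have -> : s \o c = x by apply: funext => i;
    have := congr1 (@^~ (inr i)) sdx.
apply: (Etr _ d); first apply: Esym; apply: Ed => //.
- by apply: realizes_sub dU; exact: subsetUl.
- by move=> p; rewrite -ab ac.
- by apply: realizes_sub dU; exact/setSU/subsetUl.
Qed.

End Coheir.

(** * Divisibility in finitely generated torsion-free groups *)

Lemma common_denominator (I : finType) (x : I -> rat) :
  exists2 d : nat, (0 < d)%N & exists y : I -> int,
    forall i, x i * d%:R = (y i)%:~R.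
Proof.
exists (\prod_i `|denq (x i)|)%N.
  by rewrite prodn_gt0// => i; rewrite absz_gt0 denq_eq0.
exists (fun i => numq (x i) * (\prod_(j | j != i) `|denq (x j)|)%N%:R) => i.
rewrite (bigD1 i)//= natrM mulrA natr_absz normr_denq -numqE.
by rewrite intrM natz -pmulrn.
Qed.

Lemma rat_mx_inj m n : injective (map_mx intr : 'M[int]_(m, n) ->
  'M[rat]_(m, n)).
Proof.
by move=> X Y /matrixP XY; apply/matrixP => i j; have := XY i j;
  rewrite !mxE => /intr_inj.
Qed.

Section LatticeDivisibility.
Variables (A : zmodType) (n : nat) (g : 'I_n -> A).
Implicit Types z : 'rV[int]_n.

Definition int_comb z : A := \sum_i g i *~ z 0 i.

Lemma int_combB z z' : int_comb (z - z') = int_comb z - int_comb z'.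
Proof. by rewrite -sumrB; apply: eq_bigr => i _; rewrite !mxE mulrzBr. Qed.

Lemma int_combMn z k : int_comb (z *+ k) = int_comb z *+ k.
Proof.
by rewrite -sumrMnl; apply: eq_bigr => i _;
  rewrite mulmxnE -mulr_natr mulrzA natz -pmulrn.
Qed.

Lemma int_comb_mulmx r (D : 'rV[int]_r) (R : 'M[int]_(r, n)) :
  (forall j, int_comb (row j R) = 0) -> int_comb (D *m R) = 0.
Proof.
move=> R0; rewrite /int_comb.
under eq_bigr do rewrite mxE mulrz_sumr.
rewrite exchange_big big1// => j _.
transitivity (int_comb (row j R) *~ D 0 j); last by rewrite R0 mul0rz.
by rewrite mulrz_suml; apply: eq_bigr => i _; rewrite mxE mulrC mulrzA.
Qed.

Local Notation "A ^Q" := (map_mx intr A : 'M[rat]_(_, _)) (at level 2).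

(** The group of relations between the generators is a lattice of some rank; as
there is no torsion, it contains every integer vector in its rational span. *)
Lemma relation_span :
  (forall z k, (0 < k)%N -> int_comb z *+ k = 0 -> int_comb z = 0) ->
  exists C : 'M[rat]_n, forall z, int_comb z = 0 <-> z^Q *m C = 0.
Proof.
move=> tf.
pose P k := `[< exists r (R : 'M[int]_(r, n)),
  (forall j, int_comb (row j R) = 0) /\ \rank R^Q = k >].
have exP : exists k, P k.
  exists (\rank (0 : 'M[int]_(0, n))^Q); apply/asboolP; exists 0%N, 0.
  by split=> // -[].
have Pub k : P k -> (k <= n)%N by move=> /asboolP[r [R [_ <-]]];
  exact: rank_leq_col.
(* The rows of [R] are relations, as many independent ones as possible. *)
case: (ex_maxnP exP Pub) => k /asboolP[r [R [R0 rk]]] kmax.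
exists (cokermx R^Q) => z.
suff -> : int_comb z = 0 <-> (z^Q <= R^Q)%MS by rewrite submxE; split=> /eqP.
split=> [z0|/submxP[D zDR]].
  have RRz : (R^Q <= (col_mx R z)^Q)%MS by rewrite map_col_mx -addsmxE addsmxSl.
  have zRz : (z^Q <= (col_mx R z)^Q)%MS by rewrite map_col_mx -addsmxE addsmxSr.
  apply: submx_trans zRz _; have [le_rk <-] := mxrank_leqif_sup RRz.
  rewrite eqn_leq le_rk rk; apply: kmax; apply/asboolP;
    exists (r + 1)%N, (col_mx R z).
  split=> // j; rewrite -[j]fintype.splitK; case: (fintype.split j) => i /=;
    first by rewrite rowKu.
  by rewrite rowKd [i]ord1 row_id.
have [d d0 [y yP]] := common_denominator (fun j => D 0 j).
apply: (tf z d d0).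
rewrite -int_combMn; suff ->
  : z *+ d = (\row_j y j) *m R by exact: int_comb_mulmx.
apply: rat_mx_inj.
rewrite raddfMn map_mxM /= zDR -scaler_nat scalemxAl; congr (_ *m _).
by apply/rowP => j; rewrite !mxE -yP mulrC.
Qed.

(** The map [z |-> z *m C] becomes integral after clearing denominators, and a
nonzero integer is not divisible by all powers of [q]. *)
Lemma infinitely_divisible_eq0 q z : (1 < q)%N ->
  (forall z k, (0 < k)%N -> int_comb z *+ k = 0 -> int_comb z = 0) ->
  (forall k, exists z', int_comb z = int_comb z' *+ (q ^ k)) -> int_comb z = 0.
Proof.
move=> q1 /relation_span[C CP] zdiv; apply/CP.
have [d d0 [y yP]] := common_denominator (fun ij : 'I_n * 'I_n => C ij.1 ij.2).
pose C' : 'M[int]_n := \matrix_(i, j) y (i, j).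
have C'E : C'^Q = d%:R *: C.
  by apply/matrixP => i j; rewrite !mxE -yP mulrC.
have zC' z' : z'^Q *m C = 0 <-> z' *m C' = 0.
  have -> : z'^Q *m C = 0 <-> (z' *m C')^Q = 0.
    rewrite map_mxM /= C'E -scalemxAr; split=> [->|]; first by rewrite scaler0.
    by move/eqP; rewrite scaler_eq0 Num.Theory.pnatr_eq0 gtn_eqF//= => /eqP.
  split=> [|->]; last by rewrite raddf0.
  by rewrite -(map_mx0 intr) => /rat_mx_inj.
apply/zC'/rowP => j; rewrite [RHS]mxE; apply/eqP; rewrite -absz_eq0.
apply: contraT => zj.
set x := (_ *m _) 0 j in zj *.
have [z' zz'] := zdiv `|x|%N.
have : int_comb (z - z' *+ q ^ `|x|) = 0 by rewrite int_combB int_combMn zz'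
  subrr.
move=> /CP/zC'; rewrite mulmxBl => /eqP; rewrite subr_eq0 => /eqP zz'C.
have : (q ^ `|x| %| `|x|)%N.
  rewrite {2}/x zz'C -scaler_nat -scalemxAl mxE natz abszM absz_nat.
  exact: dvdn_mulr.
move=> /dvdn_leq; rewrite lt0n => /(_ zj).
by rewrite leqNgt ltn_expl.
Qed.

End LatticeDivisibility.

(** * Subgroups, extensions and their transfer to elementary extensions *)

Lemma zmod_closedP (X : zmodType) (T : set X) : zmod_closed (mem T) <->
  T 0 /\ forall x y, T x -> T y -> T (x - y).
Proof.
split=> -[T0 TB]; split=> [|x y].
- exact: set_mem.
- by move=> /mem_set Tx /mem_set Ty; apply: set_mem; exact: TB.
- exact: mem_set.
- by move=> /set_mem Tx /set_mem Ty; apply: mem_set; exact: TB.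
Qed.

Lemma group_closedP (X : groupType) (T : set X) : group_closed (mem T) <->
  T 1%g /\ forall x y, T x -> T y -> T (x * y^-1)%g.
Proof.
split=> -[T0 TB]; split=> [|x y].
- exact: set_mem.
- by move=> /mem_set Tx /mem_set Ty; apply: set_mem; exact: TB.
- exact: mem_set.
- by move=> /set_mem Tx /set_mem Ty; apply: mem_set; exact: TB.
Qed.

Section ZmodClosed.
Variables (X : zmodType) (T : set X).
Hypothesis Tclosed : zmod_closed (mem T).

Lemma zmod_set0 : T 0. Proof. by have [] := (zmod_closedP _).1 Tclosed. Qed.
Lemma zmod_setB x y : T x -> T y -> T (x - y).
Proof. by have [_] := (zmod_closedP _).1 Tclosed; apply. Qed.
Lemma zmod_setN x : T x -> T (- x).
Proof. by rewrite -sub0r; apply: zmod_setB; exact: zmod_set0. Qed.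
Lemma zmod_setD x y : T x -> T y -> T (x + y).
Proof. by move=> Tx Ty; rewrite -[y]opprK; apply: zmod_setB => //;
  exact: zmod_setN. Qed.

End ZmodClosed.

Section GroupClosed.
Variables (X : groupType) (T : set X).
Hypothesis Tclosed : group_closed (mem T).

Lemma group_set1 : T 1%g. Proof. by have [] := (group_closedP _).1 Tclosed. Qed.
Lemma group_setMV x y : T x -> T y -> T (x * y^-1)%g.
Proof. by have [_] := (group_closedP _).1 Tclosed; apply. Qed.
Lemma group_setV x : T x -> T (x^-1)%g.
Proof. by rewrite -[x^-1%g]mul1g; apply: group_setMV; exact: group_set1. Qed.
Lemma group_setM x y : T x -> T y -> T (x * y)%g.
Proof. by move=> Tx Ty; rewrite -[y]invgK; apply: group_setMV => //;
  exact: group_setV. Qed.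

End GroupClosed.

Lemma generated_closed (X : zmodType) (S : set X) : zmod_closed (mem (generated
  S)).
Proof.
apply/zmod_closedP; split=> [T [/zmod_closedP[]]//|x y Sx Sy T TS].
by have [/zmod_setB TB _] := TS; apply: TB; [exact: Sx|exact: Sy].
Qed.

Lemma generated_sub (X : zmodType) (S T : set X) :
  zmod_closed (mem T) -> S `<=` T -> generated S `<=` T.
Proof. by move=> Tcl ST x; apply; split. Qed.

Lemma sub_generated (X : zmodType) (S : set X) : S `<=` generated S.
Proof. by move=> x Sx T [_]; apply. Qed.

(** The cocycle identity expresses [g . h x y] through values of [h]. *)
Lemma act_coc_closed (G : groupType) (A : zmodType) (ac : autAction G A)
    (h : cocycle ac) (T : set A) : zmod_closed (mem T) ->
  (forall g1 g2, T (h g1 g2)) -> forall g g1 g2, T (ac g (h g1 g2)).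
Proof.
move=> Tcl Th g g1 g2.
have -> : ac g (h g1 g2) = h g g1 + h (g * g1)%g g2 - h g (g1 * g2)%g.
  by rewrite coc_assoc addrC addKr.
by apply: zmod_setB => //; apply: zmod_setD.
Qed.

Section Extensions.
Variables (G : groupType) (A : zmodType) (ac : autAction G A) (h : cocycle ac).
Local Notation E := (extension h).

Lemma ext_mulE (x y : E) :
  (x * y)%g = ((x.1 + ac x.2 y.1 + h x.2 y.2, (x.2 * y.2)%g) : E).
Proof. by []. Qed.

Lemma ext_mul_kernel (a b : A) (g : G) :
  (((a, 1%g) : E) * ((b, g) : E))%g = (a + b, g).
Proof. by rewrite ext_mulE /= act_1 coc_1g addr0 mul1g. Qed.

Lemma ext_div_kernel (a b : A) (g : G) :
  (((a, g) : E) * ((b, g) : E)^-1)%g = (a - b, 1%g).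
Proof. by apply: canLR (mulgK _) _; rewrite ext_mul_kernel subrK. Qed.

Lemma ext_conj_kernel (a b : A) (g : G) :
  (((b, g) : E) * ((a, 1%g) : E) * ((b, g) : E)^-1)%g = (ac g a, 1%g).
Proof.
apply: canLR (mulgK _) _; rewrite ext_mul_kernel ext_mulE /= coc_g1 addr0 mulg1.
by rewrite addrC.
Qed.

End Extensions.

Section Interpretation.
Variables (L : signature) (n m : nat) (F : module_formulas L n m).
Variables (N : structure L) (G : groupType) (A : zmodType) (ac : autAction G A).
Variables (iG : G -> ('I_n -> N)) (iA : A -> ('I_m -> N)).
Hypothesis hF : interprets F ac iG iA.

Lemma A_domP x : sat (A_dom F) x <-> range iA x.
Proof. by rewrite (iA_range hF). Qed.

Lemma G_domP x : sat (G_dom F) x <-> range iG x.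
Proof. by rewrite (iG_range hF). Qed.

Lemma induced_automorphism (s : N -> N) : automorphism s ->
  exists sA : A -> A, exists sG : G -> G,
    [/\ forall a, iA (sA a) = s \o iA a, forall g, iG (sG g) = s \o iG g,
        forall a b, sA (a + b) = sA a + sA b,
        forall x y, sG (x * y)%g = (sG x * sG y)%g &
        forall g a, sA (ac g a) = ac (sG g) (sA a)].
Proof.
move=> sAut; have satE V p (v : V -> N) := sat_automorphism sAut p v.
have [sA sAP] : {sA : A -> A & forall a, iA (sA a) = s \o iA a}.
  apply: (@choice _ _ (fun a b => iA b = s \o iA a)) => a.
  have : range iA (s \o iA a); last by move=> [b _ <-]; exists b.
  by apply/A_domP; rewrite -satE; apply/A_domP; exists a.
have [sG sGP] : {sG : G -> G & forall a, iG (sG a) = s \o iG a}.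
  apply: (@choice _ _ (fun a b => iG b = s \o iG a)) => a.
  have : range iG (s \o iG a); last by move=> [b _ <-]; exists b.
  by apply/G_domP; rewrite -satE; apply/G_domP; exists a.
exists sA, sG; split=> // [a b|x y|g a].
- by apply/esym/(iA_add hF); rewrite !sAP -!comp_join -satE; apply/(iA_add hF).
- by apply/esym/(iG_mul hF); rewrite !sGP -!comp_join -satE; apply/(iG_mul hF).
- apply/esym/(iGA_act hF); rewrite !sAP sGP -!comp_join -satE.
  exact/(iGA_act hF).
Qed.

Lemma induced_extension_automorphism (P : Type) (ph : formula L ('I_n + 'I_n +
  'I_m + P))
    (b : P -> N) (h : cocycle ac) : interprets_cocycle ph b iG iA h ->
  forall s, automorphism s -> (forall p, s (b p) = b p) ->
  exists sE : extension h -> extension h,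
    (forall x, ext_incl iG iA (sE x) = s \o ext_incl iG iA x) /\
    (forall x y, sE (x * y)%g = (sE x * sE y)%g).
Proof.
move=> hph s sAut sb.
have [sA [sG [sAE sGE sAD sGM sact]]] := induced_automorphism sAut.
have sh x y : sA (h x y) = h (sG x) (sG y).
  apply/esym/hph; rewrite !sAE !sGE -!comp_join.
  have -> : b = s \o b by apply: funext => p /=; rewrite sb.
  by rewrite -comp_join -(sat_automorphism sAut); apply/hph.
exists (fun x => (sA x.1, sG x.2)); split=> [x|x y].
  by rewrite /ext_incl /= sAE sGE comp_join.
by rewrite !ext_mulE /= !sAD sact sh sGM.
Qed.

End Interpretation.

Lemma elementary_inj L (M N : structure L) (e : M -> N) :
  elementary e -> injective e.
Proof.
move=> eE x y exy.
by apply/(eE bool (Equal (Var L true) (Var L false)) (fun c =>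
  if c then x else y)).
Qed.

Section Transfer.
Variables (L : signature) (n m : nat) (F : module_formulas L n m).
Variables (M N : structure L) (e : M -> N).
Variables (G : groupType) (A : zmodType) (ac : autAction G A).
Variables (iG : G -> ('I_n -> M)) (iA : A -> ('I_m -> M)).
Variables (Gs : groupType) (As : zmodType) (acs : autAction Gs As).
Variables (iGs : Gs -> ('I_n -> N)) (iAs : As -> ('I_m -> N)).
Variables (B : set M) (ph : formula L ('I_n + 'I_n + 'I_m + B)).
Variables (h : cocycle ac) (hs : cocycle acs).
Hypotheses (eE : elementary e).
Hypotheses (hF : interprets F ac iG iA) (hFs : interprets F acs iGs iAs).
Hypothesis hph : interprets_cocycle ph (fun b : B => val b) iG iA h.
Hypothesis hphs : interprets_cocycle ph (fun b : B => e (val b)) iGs iAs hs.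

Lemma exists_transfer_maps : exists jA : A -> As, exists jG : G -> Gs,
  [/\ (forall a, iAs (jA a) = e \o iA a) /\ (forall a b, jA (a + b) = jA a + jA
    b),
      forall x y, jG (x * y)%g = (jG x * jG y)%g,
      injective jA,
      forall g a, jA (ac g a) = acs (jG g) (jA a) &
      forall x y, jA (h x y) = hs (jG x) (jG y)].
Proof.
have [jA jAP] : {jA : A -> As & forall a, iAs (jA a) = e \o iA a}.
  apply: (@choice _ _ (fun a b => iAs b = e \o iA a)) => a.
  have : range iAs (e \o iA a); last by move=> [b _ <-]; exists b.
  by apply/(A_domP hFs); rewrite -eE; apply/(A_domP hF); exists a.
have [jG jGP] : {jG : G -> Gs & forall a, iGs (jG a) = e \o iG a}.
  apply: (@choice _ _ (fun a b => iGs b = e \o iG a)) => a.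
  have : range iGs (e \o iG a); last by move=> [b _ <-]; exists b.
  by apply/(G_domP hFs); rewrite -eE; apply/(G_domP hF); exists a.
exists jA, jG; split.
- split=> // a b.
  by apply/esym/(iA_add hFs); rewrite !jAP -!comp_join -eE; apply/(iA_add hF).
- move=> x y.
  by apply/esym/(iG_mul hFs); rewrite !jGP -!comp_join -eE; apply/(iG_mul hF).
- move=> a b jab; apply: (iA_inj hF); apply: funext => i.
  apply: (elementary_inj eE).
  by rewrite -[LHS](congr1 (@^~ i) (jAP a)) -[RHS](congr1 (@^~ i) (jAP b)) jab.
- move=> g a; apply/esym/(iGA_act hFs); rewrite !jAP jGP -!comp_join -eE.
  exact/(iGA_act hF).
- move=> x y; apply/esym/hphs; rewrite !jAP !jGP.
  by rewrite -!comp_join -eE; apply/hph.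
Qed.

(** That all values of the cocycle belong to a given finite set is a first-order
property of its elements, which holds in the small model. *)
Lemma coc_image_transfer (jA : A -> As) : (forall a, iAs (jA a) = e \o iA a) ->
  finite_set (coc_image h) ->
  forall x y, exists2 a, coc_image h a & hs x y = jA a.
Proof.
move=> jAP hfin x y; apply: contrapT => Nxy.
pose fG1 (i : 'I_n) : M + ('I_n + 'I_n) := inr (inl i).
pose fG2 (i : 'I_n) : M + ('I_n + 'I_n) := inr (inr i).
pose fh a (u : 'I_n + 'I_n + 'I_m + B) : M + ('I_n + 'I_n) := match u with
  | inl (inl (inl i)) => fG1 i
  | inl (inl (inr i)) => fG2 i
  | inl (inr j) => inl (iA a j)
  | inr b => inl (val b) end.
pose S := [set Not (ren (fh a) ph) | a in coc_image h] `|`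
  [set ren fG1 (G_dom F); ren fG2 (G_dom F)].
have [q qP] : exists q : formula L (M + ('I_n + 'I_n)), forall (O : structure
  L) (v : _ -> O),
    sat q v <-> forall p, S p -> sat p v.
  by apply: finite_conj; rewrite finite_setU; split;
    [exact: finite_image|exact: finite_set2].
have [t tP] := finite_exists q.
have fhE (O : structure L) (c : M -> O) (u v : 'I_n -> O) a :
    join c (join u v) \o fh a = join (join (join u v) (c \o iA a)) (fun b : B
      => c (val b)).
  by apply: funext => -[[[]|]|].
have qE (O : structure L) (c : M -> O) (u v : 'I_n ->
  O) : sat q (join c (join u v)) <->
   [/\ sat (G_dom F) u, sat (G_dom F) v & forall a, coc_image h a ->
    ~ sat ph (join (join (join u v) (c \o iA a)) (fun b : B => c (val b)))].
  rewrite qP; split=> [H|[Hu Hv H] _ [[a ha <-]|[|]->]].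
  - have Hu := H _ (or_intror (or_introl erefl)).
    have Hv := H _ (or_intror (or_intror erefl)).
    move: Hu Hv; rewrite !sat_ren => Hu Hv; split=> // a ha.
    have /H : S (Not (ren (fh a) ph)) by left; exists a.
    by move=> /sat_Not; rewrite sat_ren fhE.
  - by apply/sat_Not; rewrite sat_ren fhE; exact: H.
  - by rewrite sat_ren.
  - by rewrite sat_ren.
have domGs (g : Gs) : sat (G_dom F) (iGs g) by apply/(G_domP hFs); exists g.
have : sat t (e \o id).
  apply/tP; exists (join (iGs x) (iGs y)); apply/qE; split=> // a ha.
  rewrite -jAP => /hphs hxy; apply: Nxy; exists a => //.
move/eE/tP => [w]; have ->
  : w = join (w \o inl) (w \o inr) by apply: funext => -[].
move=> /qE[].
move=> /(G_domP hF)[g _ <-] /(G_domP hF)[k _ <-] /(_ (h g k)); apply;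
  first by exists g, k.
exact/hph.
Qed.

Lemma dcl_fixed (s : N -> N) (x : M) : automorphism s ->
  (forall b, B b -> s (e b) = e b) -> dcl B x -> s (e x) = e x.
Proof.
move=> sAut sB [p px].
pose f (u : unit + B) : option M := if u is inr b then Some (val b) else None.
pose q := All (Imp (ren f p) (Equal (Var L None) (Var L (Some x)))).
have fE (O : structure L) (c : M -> O) y :
    extend y c \o f = join (fun=> y) (fun b : B => c (val b)).
  by apply: funext => -[].
have qE (O : structure L) (c : M -> O) :
    sat q c <-> forall y, sat (ren f p) (extend y c) -> y = c x by [].
have /qE/(_ (s (e x))) : sat q (e \o id).
  by apply/eE/qE => y; rewrite sat_ren fE => /(px (fun=> y)).
rewrite sat_ren fE; apply.
have : sat p (join (fun=> x) (fun b : B => val b)) by apply/px.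
move/eE/(sat_automorphism sAut); rewrite !comp_join.
suff -> : s \o (e \o (fun b : B => val b)) = (fun b : B => e (val b)) by [].
by apply: funext => b /=; apply: sB; exact: set_valP.
Qed.

End Transfer.

(** * Subgroups of bounded index and existence of the components *)

Lemma cosets_eq (X : groupType) (H : set X) :
  group_closed (mem H) -> forall x y,
  [set (x * z)%g | z in H] = [set (y * z)%g | z in H] <-> H (x^-1 * y)%g.
Proof.
move=> Hcl x y; split=> [xy|Hxy].
  have : [set (y * z)%g | z in H] y by exists 1%g;
    [exact: group_set1|rewrite mulg1].
  by rewrite -xy => -[z Hz <-]; rewrite mulKg.
apply/seteqP; split=> _ [z Hz <-].
  exists (y^-1 * x * z)%g; last by rewrite -!mulgA mulVKg.
  by apply: group_setM => //; rewrite -[x]invgK -invgM; exact: group_setV.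
exists (x^-1 * y * z)%g; last by rewrite -!mulgA mulVKg.
exact: group_setM.
Qed.

Lemma cosets_add_eq (X : zmodType) (H : set X) :
  zmod_closed (mem H) -> forall x y,
  [set x + z | z in H] = [set y + z | z in H] <-> H (y - x).
Proof.
move=> Hcl x y; split=> [xy|Hxy].
  have : [set y + z | z in H] y by exists 0; [exact: zmod_set0|rewrite addr0].
  by rewrite -xy => -[z Hz <-]; rewrite addrC addKr.
apply/seteqP; split=> _ [z Hz <-].
  exists (z - (y - x)); first exact: zmod_setB.
  by rewrite opprB addrC addrA subrK addrC.
exists (z + (y - x)); first exact: zmod_setD.
by rewrite addrC -addrA subrK addrC.
Qed.

Section BoundedIndex.
Variables (L : signature) (M N : structure L) (e : M -> N) (K : Type).
Hypothesis mon : monster K e.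
Local Notation M0 := (range e).
Let T : Type := (M + (fun_sym L + rel_sym L) + nat)%type.

Let eE : elementary e. Proof. by have [] := mon. Qed.
Let Tsm : small K [set: set T]. Proof. by have [] := mon. Qed.
Let Nsat : saturated K N. Proof. by have [] := mon. Qed.
Let Nhom : strongly_homogeneous K N. Proof. by have [] := mon. Qed.

Let embeds_set (U : Type) : embeds U T -> small K [set: set U].
Proof.
move=> [f fI]; apply: (small_inj (f := fun A => f @` A)) Tsm => // A B _ _ AB.
apply/seteqP; split=> x Ax.
  have : (f @` B) (f x) by rewrite -AB; exists x.
  by move=> [y By /fI <-].
have : (f @` A) (f x) by rewrite AB; exists x.
by move=> [y By /fI <-].
Qed.

Lemma monster_infinite : embeds nat K.
Proof.
have [//|[f fI]] := embeds_total nat K.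
have /smallP[] := Tsm; exists (fun k => [set inr (f k) : T]) => // x y.
by move=> /seteqP[/(_ (inr (f x)))] /(_ erefl) [/fI].
Qed.

Lemma small_submodel : small K M0.
Proof.
apply: small_image.
apply: (@small_inj K _ _ _ setT (fun m => [set inl (inl m) : T])) Tsm => //.
by move=> x y _ _ /seteqP[/(_ (inl (inl x)))] /(_ erefl) [].
Qed.

Definition tp (V : Type) (x : V -> N) : set (formula L (V + M0)) :=
  [set p | holds p x].

Lemma tp_eq (V : Type) (x y : V -> N) : tp x = tp y <-> same_type M0 x y.
Proof.
split=> [xy p|xy]; last by apply/seteqP; split=> p /xy.
by have /seteqP[H1 H2] := xy; split=> [/H1|/H2].
Qed.

Lemma small_types (V : finType) : small K [set: set (formula L (V + M0))].
Proof.
apply: embeds_set; apply: embeds_formula.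
- by exists inr; exact: inr_inj.
- by exists (fun l => inl (inr l)) => x y [].
have [g gP] : {g : M0 -> M & forall c, e (g c) = val c}.
  apply: (@choice _ _ (fun (c : M0) m => e m = val c)) => c.
  by have [m _ em] := set_valP c; exists m.
exists (fun u : V + M0 => match u with
  | inl v => inr (enum_rank v : nat) | inr c => inl (inl (g c)) end).
move=> [v|c] [w|d] // [].
  by move=> /val_inj/enum_rank_inj ->.
by move=> cd; congr inr; apply: val_inj; rewrite -!gP cd.
Qed.

(** The coset of an element is determined by its type, and there are few types. *)
Lemma bounded_index_of_types (V : finType) (X : groupType) (iX : X -> (V -> N))
    (H : set X) : group_closed (mem H) ->
  (forall x y, same_type M0 (iX x) (iX y) -> H (x^-1 * y)%g) ->
    bounded_index K H.
Proof.
move=> Hcl tpH.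
have := small_image (fun t =>
  [set z | exists2 x, tp (iX x) = t & H (x^-1 * z)%g])
  (@small_types V).
apply: small_sub => _ [x _ <-]; exists (tp (iX x)) => //.
apply/seteqP; split=> z.
  move=> [y /tp_eq/tpH xy yz]; exists (x^-1 * z)%g; last by rewrite mulVKg.
  have -> : (x^-1 * z = (y^-1 * x)^-1 * (y^-1 * z))%g.
    by rewrite invgM invgK mulgA mulgK.
  by apply: group_setM => //; exact: group_setV.
by move=> [y Hy <-]; exists x; rewrite ?mulKg.
Qed.

Lemma bounded_index_add_of_types (V : finType) (X : zmodType) (iX : X ->
  (V -> N))
    (H : set X) : zmod_closed (mem H) ->
  (forall x y, same_type M0 (iX x) (iX y) -> H (y - x)) ->
    bounded_index_add K H.
Proof.
move=> Hcl tpH.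
have := small_image (fun t => [set z | exists2 x, tp (iX x) = t & H (z - x)])
  (@small_types V).
apply: small_sub => _ [x _ <-]; exists (tp (iX x)) => //.
apply/seteqP; split=> z.
  move=> [y /tp_eq/tpH xy yz]; exists (z - x); last by rewrite addrC subrK.
  have -> : z - x = (z - y) - (x - y) by rewrite opprB addrA subrK.
  exact: zmod_setB.
by move=> [y Hy <-]; exists x; rewrite // addrC addKr.
Qed.

(** Cosets enter as the values of a map [c], which covers multiplicative and
additive groups at once. *)
Lemma same_type_class (V : finType) (X Y : Type) (iX : X -> (V -> N))
    (c : X -> Y) : injective iX -> small K (range c) ->
  (forall s, automorphism s -> (forall m, M0 m -> s m = m) ->
     exists2 sX : X -> X, forall x, iX (sX x) = s \o iX x &
       forall x y, c x = c y -> c (sX x) = c (sX y)) ->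
  forall x y, same_type M0 (iX x) (iX y) -> c x = c y.
Proof.
move=> iXI csm sigma x y xy.
pose E u v := exists x y, [/\ u = iX x, v = iX y & c x = c y].
suff [x' [y' [/iXI -> /iXI -> //]]] : E (iX x) (iX y).
pose rep t := if pselect (exists x, c x = t) is left tx then iX (projT1 (cid
  tx))
  else iX x.
apply: (same_type_related eE monster_infinite Nsat Nhom
  small_submodel (E := E) (I := range iX) (R := rep @` range c)) xy.
- move=> s sA sM0; have [sX sXE sXc] := sigma s sA sM0; split.
    by move=> _ [z _ <-]; rewrite -sXE; exists (sX z).
  by move=> _ _ [u [v [-> -> uv]]]; exists (sX u), (sX v); split; auto.
- by move=> _ _ [u [v [-> -> uv]]]; exists v, u.
- move=> _ _ w [u [v [-> -> uv]]] [v' [w' [/iXI <- -> vw]]].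
  by exists u, w'; rewrite uv.
- exact: small_image.
- move=> _ [u _ <-]; exists (rep (c u)); first by exists (c u) => //; exists u.
  rewrite /rep; case: pselect => [cu|[]]; last by exists u.
  by case: (cid cu) => v /= vu; exists u, v.
- by exists x.
Qed.

Lemma Aut_invariant_map (V : Type) (X : Type) (iX : X -> (V -> N)) (C : set N)
    (H : set X) (s : N -> N) (sX : X -> X) : injective iX ->
  Aut_invariant C (iX @` H) -> automorphism s -> (forall c, C c -> s c = c) ->
  (forall x, iX (sX x) = s \o iX x) -> forall x, H x -> H (sX x).
Proof.
move=> iXI Hinv sA sC sXE x Hx.
have [|z Hz] := Hinv s sA sC (iX x); first by exists x.
by rewrite -sXE => /iXI <-.
Qed.

Section Groups.
Variables (C : set N) (V : finType) (X : groupType) (iX : X -> (V -> N)).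
Hypotheses (CM0 : C `<=` M0) (iXI : injective iX).
Hypothesis sigma : forall s, automorphism s -> (forall c, C c -> s c = c) ->
  exists2 sX : X -> X, forall x, iX (sX x) = s \o iX x &
    {morph sX : x y / (x * y)%g}.

Lemma same_type_bounded_index (H : set X) : group_closed (mem H) ->
  bounded_index K H -> Aut_invariant C (iX @` H) ->
  forall x y, same_type M0 (iX x) (iX y) -> H (x^-1 * y)%g.
Proof.
move=> Hcl Hbdd Hinv x y xy; apply/(cosets_eq Hcl).
apply: (same_type_class (c := fun x => [set (x * z)%g | z in H]) iXI _ _ xy).
  by [].
move=> s sA sM0; have sC c : C c -> s c = c by move=> /CM0; exact: sM0.
have [sX sXE sXM] := sigma sA sC; exists sX => // u v /(cosets_eq Hcl) uv.
apply/(cosets_eq Hcl); have -> : ((sX u)^-1 * sX v = sX (u^-1 * v))%g.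
  by apply: (canLR (mulKg _)); rewrite -sXM mulVKg.
exact: (Aut_invariant_map iXI Hinv sA sC sXE).
Qed.

Lemma group_closed_bigcap (I : Type) (D : set I) (F : I -> set X) :
  (forall i, D i -> group_closed (mem (F i))) ->
  group_closed (mem (\bigcap_(i in D) F i)).
Proof.
move=> Fcl; apply/group_closedP; split=> [i Di|x y Fx Fy i Di].
  by apply: group_set1; exact: Fcl.
by apply: group_setMV; [exact: Fcl|exact: Fx|exact: Fy].
Qed.

Lemma exists_component000 : exists E, is_component000 K C iX E.
Proof.
pose P (H : set X) := [/\ group_closed (mem H), bounded_index K H &
  Aut_invariant C (iX @` H)].
have Pcl : group_closed (mem (\bigcap_(H in P) H)).
  by apply: group_closed_bigcap => H [].
exists (\bigcap_(H in P) H); split; last by move=> H PH x; exact.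
split=> //.
  apply: (bounded_index_of_types Pcl) => x y xy H [Hcl Hbdd Hinv].
  exact: same_type_bounded_index.
move=> s sA sC _ [x Px <-]; have [sX sXE _] := sigma sA sC.
exists (sX x) => // H PH; apply: (Aut_invariant_map iXI _ sA sC sXE);
  last exact: Px.
by case: PH.
Qed.

Lemma type_definable_bigcap_image (D : set (set X)) :
  type_definable C (range iX) -> (forall H, D H ->
    type_definable C (iX @` H)) ->
  type_definable C (iX @` \bigcap_(H in D) H).
Proof.
move=> Xtd Dtd.
have -> : iX @` (\bigcap_(H in D) H) = range iX `&` \bigcap_(H in D) (iX @` H).
  apply/seteqP; split=> [_ [x Dx <-]|_ [[x _ <-] Dx]].
    by split=> [|H DH]; exists x => //; exact: Dx.
  by exists x => // H DH; have [z Hz /iXI <-] := Dx H DH.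
exact/type_definableI/type_definable_bigcap.
Qed.

Lemma exists_component00 : type_definable C (range iX) ->
  exists E, is_component00 K C iX E.
Proof.
move=> Xtd; pose P (H : set X) := [/\ group_closed (mem H), bounded_index K H &
  type_definable C (iX @` H)].
have Pcl : group_closed (mem (\bigcap_(H in P) H)).
  by apply: group_closed_bigcap => H [].
exists (\bigcap_(H in P) H); split; last by move=> H PH x; exact.
split=> //.
  apply: (bounded_index_of_types Pcl) => x y xy H [Hcl Hbdd Htd].
  by apply: same_type_bounded_index => //; exact: type_definable_Aut_invariant.
by apply: type_definable_bigcap_image => // H [].
Qed.

End Groups.

Lemma same_type_bounded_index_add (C : set N) (V : finType) (X : zmodType)
    (iX : X -> (V -> N)) (H : set X) : C `<=` M0 -> injective iX ->
  (forall s, automorphism s -> (forall c, C c -> s c = c) ->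
    exists2 sX : X -> X, forall x, iX (sX x) = s \o iX x &
      {morph sX : x y / x + y}) ->
  zmod_closed (mem H) -> bounded_index_add K H -> Aut_invariant C (iX @` H) ->
  forall x y, same_type M0 (iX x) (iX y) -> H (y - x).
Proof.
move=> CM0 iXI sigma Hcl Hbdd Hinv x y xy; apply/(cosets_add_eq Hcl).
apply: (same_type_class (c := fun x => [set x + z | z in H]) iXI _ _ xy).
  by [].
move=> s sA sM0; have sC c : C c -> s c = c by move=> /CM0; exact: sM0.
have [sX sXE sXD] := sigma s sA sC; exists sX => // u v /(cosets_add_eq Hcl) uv.
apply/(cosets_add_eq Hcl); have -> : sX v - sX u = sX (v - u).
  by apply/eqP; rewrite subr_eq -sXD subrK.
exact: (Aut_invariant_map iXI Hinv sA sC sXE).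
Qed.

End BoundedIndex.

(** * Type-definability of subsets of the extension *)

Section DefinableSets.
Variables (K : Type) (L : signature) (n m : nat) (F : module_formulas L n m).
Variables (N : structure L) (G : groupType) (A : zmodType) (ac : autAction G A).
Variables (iG : G -> ('I_n -> N)) (iA : A -> ('I_m -> N)) (h : cocycle ac).
Hypotheses (hF : interprets F ac iG iA) (Kinf : embeds nat K)
  (Nsat : saturated K N).
Variable C : set N.
Hypothesis Csm : small K C.
Local Notation E := (extension h).
Local Notation iE := (ext_incl iG iA (h := h)).

Lemma type_definable_sat V (p : formula L V) :
  type_definable C [set x : V -> N | sat p x].
Proof.
have -> : [set x : V -> N | sat p x] = [set x | @holds _ _ C _ (ren inl p) x].
  apply/funext => x /=; apply/propext; rewrite /holds sat_ren.
  by have -> : join x (fun c : C => val c) \o inl = x by apply: funext.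
exact: type_definable_formula.
Qed.

Lemma type_definable_sat_comp V W (f : V -> W) (p : formula L V) :
  type_definable C [set x : W -> N | sat p (x \o f)].
Proof. exact: (type_definable_preimage f (type_definable_sat p)). Qed.

Lemma iE_inj : injective iE.
Proof.
move=> [a g] [b k] /= ab; congr pair.
  by apply: (iA_inj hF); apply: funext => i; have := congr1 (@^~ (inl i)) ab.
by apply: (iG_inj hF); apply: funext => i; have := congr1 (@^~ (inr i)) ab.
Qed.

Lemma type_definable_range_iE : type_definable C (range iE).
Proof.
have -> : range iE = [set x : 'I_m + 'I_n -> N | sat (A_dom F) (x \o inl)] `&`
                     [set x : 'I_m + 'I_n -> N | sat (G_dom F) (x \o inr)].
  apply/seteqP; split=> [_ [[a g] _ <-]|x [/= xA xG]].
    by split=> /=; [apply/(A_domP hF); exists a|apply/(G_domP hF); exists g].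
  have [a _ ax] := (A_domP hF _).1 xA; have [g _ gx] := (G_domP hF _).1 xG.
  exists (a, g) => //; apply: funext => -[i|i] /=.
    by rewrite ax.
  by rewrite gx.
by apply: type_definableI; exact: type_definable_sat_comp.
Qed.

Lemma type_definable_snd (H : set E) : type_definable C (iE @` H) ->
  type_definable C (iG @` (snd @` H)).
Proof.
move=> Htd; have := type_definable_image Kinf Nsat (@inr 'I_m 'I_n) Csm Htd.
congr type_definable; apply/seteqP; split.
  by move=> _ [_ [x Hx <-] <-]; exists x.2 => //; exists x.
by move=> _ [_ [x Hx <-] <-]; exists (iE x) => //; exists x.
Qed.

Lemma type_definable_kernel (H : set E) : type_definable C (iE @` H) ->
  type_definable C (iA @` [set a | H (a, 1%g)]).
Proof.
move=> Htd.
have one : type_definable C [set iG 1%g].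
  have -> : [set iG 1%g] = [set x | sat (G_dom F) x] `&`
      [set x : 'I_n -> N | sat (G_mul F) (x \o (fun u => match u with
         inl (inl i) => i | inl (inr i) => i | inr i => i end))].
    have E x : x \o (fun u : 'I_n + 'I_n + 'I_n => match u with
       inl (inl i) => i | inl (inr i) => i | inr i =>
         i end) = join (join x x) x :> (_ -> N).
      by apply: funext => -[[]|].
    apply/seteqP; split=> [_ ->|x [/(G_domP hF)[g _ <-]]] /=.
      split; first by apply/(G_domP hF); exists 1%g.
      by rewrite /= E; apply/(iG_mul hF); rewrite mulg1.
    rewrite E => /(iG_mul hF) gg; congr iG.
    by rewrite -[LHS](mulKg g) gg mulVg.
  apply: type_definableI; first exact: type_definable_sat.
  exact: type_definable_sat_comp.
have onepre := @type_definable_preimage _ _ _ _ _ (@inr 'I_m 'I_n) _ one.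
have := type_definable_image Kinf Nsat (@inl 'I_m 'I_n) Csm
   (type_definableI Htd onepre).
congr type_definable; apply/seteqP; split.
  move=> _ [_ [[[a g] Hag <-] /= ag] <-]; exists a => //=.
  suff <- : g = 1%g by [].
  by apply: (iG_inj hF).
by move=> _ [a Ha <-]; exists (iE (a, 1%g)) => //; split=> //; exists (a, 1%g).
Qed.

(** With parameter [t] and modulo [D], this is the image of [Y] under
[y |-> t - 2 y], whose iteration yields the 2-adic expansion of [t / 3]. *)
Lemma type_definable_step (T Y D : set A) (t : A) : (forall i, C (iA t i)) ->
  type_definable C (iA @` T) -> type_definable C (iA @` Y) ->
  type_definable C (iA @` D) ->
  type_definable C (iA @`
    [set z | T z /\ exists y u, [/\ Y y, D u & z + y + y = t + u]]).
Proof.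
move=> Ct Ttd Ytd Dtd.
pose pr (k : 'I_6) (j : 'I_m) := (k, j).
have pre k (X : set ('I_m -> N)) : type_definable C X ->
  type_definable C [set x : 'I_6 * 'I_m -> N | X (x \o pr k)].
  exact: type_definable_preimage.
pose add3 (i j k : 'I_6) (u : 'I_m + 'I_m + 'I_m) := match u with
  inl (inl l) => (i, l) | inl (inr l) => (j, l) | inr l => (k, l) end.
have addtd i j k : type_definable C [set x : 'I_6 * 'I_m -> N |
    sat (A_add F) (x \o add3 i j k)].
  exact: type_definable_sat_comp.
have add3E (x : 'I_6 * 'I_m -> N) i j k : x \o add3 i j k =
    join (join (x \o pr i) (x \o pr j)) (x \o pr k).
  by apply: funext => -[[]|].
pose o k : 'I_6 := inord k.
pose Q := [set x : 'I_6 * 'I_m -> N | (iA @` T) (x \o pr (o 0%N))] `&`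
  ([set x : 'I_6 * 'I_m -> N | (iA @` Y) (x \o pr (o 1%N))] `&`
  ([set x : 'I_6 * 'I_m -> N | (iA @` D) (x \o pr (o 2%N))] `&`
  ([set x : 'I_6 * 'I_m -> N | [set iA t] (x \o pr (o 3%N))] `&`
  ([set x : 'I_6 * 'I_m -> N | sat (A_dom F) (x \o pr (o 4%N))] `&`
  ([set x : 'I_6 * 'I_m -> N | sat (A_dom F) (x \o pr (o 5%N))] `&`
  ([set x : 'I_6 * 'I_m ->
    N | sat (A_add F) (x \o add3 (o 0%N) (o 1%N) (o 4%N))] `&`
  ([set x : 'I_6 * 'I_m ->
    N | sat (A_add F) (x \o add3 (o 4%N) (o 1%N) (o 5%N))] `&`
   [set x : 'I_6 * 'I_m ->
     N | sat (A_add F) (x \o add3 (o 3%N) (o 2%N) (o 5%N))]))))))).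
have Qtd : type_definable C Q.
  by do ![apply: type_definableI]; try apply: pre => //;
    (exact: type_definable_sat || exact: type_definable_sat_comp || exact:
      type_definable_const).
have := type_definable_image Kinf Nsat (pr (o 0%N)) Csm Qtd.
congr type_definable; apply/seteqP; split.
  move=> _ [x [[z Tz xz] [[y Yy xy] [[u Du xu] [/= xt [x4 [x5 [a1 [a2
    a3]]]]]]]] <-].
  have [v _ xv] := (A_domP hF _).1 x4; have [w _ xw] := (A_domP hF _).1 x5.
  move: a1 a2 a3; rewrite /= !add3E -xz -xy -xu xt -xv -xw.
  move=> /(iA_add hF) zy /(iA_add hF) vy /(iA_add hF) tu.
  by exists z => //; split=> //; exists y, u; rewrite zy vy tu.
move=> _ [z [Tz [y [u [Yy Du zyu]]]] <-].
pose l := [:: z; y; u; t; z + y; t + u].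
pose x (kj : 'I_6 * 'I_m) := iA (nth 0 l kj.1) kj.2.
have xE k : (k < 6)%N -> x \o pr (o k) = iA (nth 0 l k).
  by move=> k6; apply: funext => j; rewrite /x /= inordK.
exists x; last by rewrite xE.
rewrite /Q /= !add3E !xE//=; do ![split] => //.
- by exists z.
- by exists y.
- by exists u.
- by apply/(A_domP hF); exists (z + y).
- by apply/(A_domP hF); exists (t + u).
- exact/(iA_add hF).
- exact/(iA_add hF).
- exact/(iA_add hF).
Qed.

End DefinableSets.

(** * Splitting a cocycle along a subgroup of the extension *)

(** As a finitely generated group, this is a quotient of a lattice [Z^r], to which
[infinitely_divisible_eq0] applies. *)
Lemma generated_residual (A : zmodType) (S : set A) (q : nat) (a : A) :
  finite_set S -> torsion_free (generated S) -> (1 < q)%N ->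
  (forall k, exists2 c, generated S c & a = c *+ (q ^ k)) -> a = 0.
Proof.
move=> /finite_listP[s sS] tf q1 adiv.
pose g (i : 'I_(size s)) := nth 0 s i.
have sg x : S x -> exists i, x = g i.
  move=> /sS {sS tf adiv}; rewrite /g; clear g;
    elim: s => //= y s IHs [->|/IHs[i ->]].
    by exists ord0.
  by exists (lift ord0 i).
have gS i : generated S (g i).
  apply: sub_generated; apply/sS.
  have : g i \in s by rewrite mem_nth.
  elim: (s) => //= y r IHr; rewrite inE => /predU1P[->|/IHr]; by [left|right].
have combS z : generated S (int_comb g z).
  have Scl := generated_closed S.
  have Sn x k : generated S x -> generated S (x *+ k).
    move=> Sx; elim: k => [|k IHk]; first exact: (zmod_set0 Scl).
    by rewrite mulrS; apply: (zmod_setD Scl).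
  rewrite /int_comb; elim: (index_enum _) => [|i r IHr].
    by rewrite big_nil; exact: (zmod_set0 Scl).
  rewrite big_cons; apply: (zmod_setD Scl) => //; case: (z 0 i) => k.
    exact: Sn.
  by apply: (zmod_setN Scl) => //; exact: Sn.
have Scomb : generated S `<=` range (int_comb g).
  apply: generated_sub.
    apply/zmod_closedP; split.
      by exists (0 - 0) => //; rewrite int_combB subrr.
    by move=> _ _ [z _ <-] [w _ <-]; exists (z - w) => //; rewrite int_combB.
  move=> _ /sg[i ->]; exists (delta_mx 0 i) => //.
  rewrite /int_comb (bigD1 i)//= big1 ?addr0; first by rewrite mxE !eqxx.
  by move=> j /negPf ji; rewrite mxE ji andbF.
have [c /Scomb[z _ zc] ac] := adiv 0%N.
rewrite ac expn0 mulr1n -zc; apply: (infinitely_divisible_eq0 q1).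
  by move=> w k k0; apply: tf.
move=> k; have [d /Scomb[w _ wd] ad] := adiv k.
by exists w; rewrite wd -ad ac mulr1n.
Qed.

Section PullBack.
Variables (G : groupType) (A : zmodType) (ac : autAction G A) (h : cocycle ac).
Variables (Gs : groupType) (As : zmodType) (acs : autAction Gs As) (hs :
  cocycle acs).
Variables (jA : A -> As) (jG : G -> Gs) (A0 : set A).
Hypotheses (jAI : injective jA) (jAD : {morph jA : a b / a + b})
  (jGM : {morph jG : x y / (x * y)%g})
  (jact : forall g a, jA (ac g a) = acs (jG g) (jA a))
  (jh : forall x y, jA (h x y) = hs (jG x) (jG y)).
Hypotheses (A0E : A0 = generated (coc_image h))
  (hsE : forall x y, exists2 a, coc_image h a & hs x y = jA a).
Local Notation Es := (extension hs).

Lemma jA0 : jA 0 = 0.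
Proof. by apply: (addrI (jA 0)); rewrite -jAD !addr0. Qed.

Lemma jAN a : jA (- a) = - jA a.
Proof. by apply: (addrI (jA a)); rewrite -jAD !subrr jA0. Qed.

Lemma jAB a b : jA (a - b) = jA a - jA b.
Proof. by rewrite jAD jAN. Qed.

Lemma jG1 : jG 1%g = 1%g.
Proof. by apply: (mulgI (jG 1%g)); rewrite -jGM !mulg1. Qed.

Lemma A0_closed : zmod_closed (mem A0).
Proof. by rewrite A0E; exact: generated_closed. Qed.

Lemma hA0 x y : A0 (h x y).
Proof. by rewrite A0E; apply: sub_generated; exists x, y. Qed.

Lemma hsA0 x y : exists2 a, A0 a & hs x y = jA a.
Proof. by have [_ [g [k <-]] ->] := hsE x y; exists (h g k) => //;
  exact: hA0. Qed.

Lemma jA0_closed : zmod_closed (mem (jA @` A0)).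
Proof.
apply/zmod_closedP; split.
  by exists 0; [exact: (zmod_set0 A0_closed)|exact: jA0].
move=> _ _ [a Aa <-] [b Ab <-]; exists (a - b); last by rewrite jAB.
exact: (zmod_setB A0_closed).
Qed.

Lemma act_jA0 g a : A0 a -> (jA @` A0) (acs g (jA a)).
Proof.
rewrite A0E => /generated_sub; rewrite -A0E.
move=> /(_ [set a | forall g, (jA @` A0) (acs g (jA a))]); apply.
  apply/zmod_closedP; split=> [k|x y Hx Hy k].
    by rewrite jA0 act_0; exact: (zmod_set0 jA0_closed).
  by rewrite jAB act_D act_N; exact: (zmod_setB jA0_closed).
move=> _ [x [y <-]] k; rewrite jh.
apply: (act_coc_closed jA0_closed) => g1 g2.
by have [b Ab ->] := hsA0 g1 g2; exists b.
Qed.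

Lemma act_A0 g a : A0 a -> A0 (ac g a).
Proof. by move=> /(act_jA0 (jG g)); rewrite -jact => -[b Ab /jAI <-]. Qed.

Lemma fiber_group_closed (D : set As) : zmod_closed (mem D) ->
  (forall g a, D a -> D (acs g a)) -> (forall x y, D (hs x y)) ->
  group_closed (mem [set x : Es | D x.1]).
Proof.
move=> Dcl Dact Dh; apply/group_closedP; split; first exact: (zmod_set0 Dcl).
move=> x y /= Dx Dy; apply: (zmod_setD Dcl) => //; apply: (zmod_setD Dcl) => //.
by apply/Dact/(zmod_setN Dcl)/Dact/(zmod_setD Dcl).
Qed.

Section Subgroup.
Variable U : set As.
Hypotheses (Ucl : zmod_closed (mem U)) (Uact : forall g a, U a -> U (acs g a)).

Definition sumset : set As :=
  [set a | exists a0 u, [/\ A0 a0, U u & a = jA a0 + u]].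

Lemma sumset_closed : zmod_closed (mem sumset).
Proof.
apply/zmod_closedP; split.
  by exists 0, 0; split; rewrite ?jA0 ?addr0//;
    [exact: (zmod_set0 A0_closed)|exact: (zmod_set0 Ucl)].
move=> _ _ [a [u [Aa Uu ->]]] [b [v [Ab Uv ->]]]; exists (a - b), (u - v);
  split.
- exact: (zmod_setB A0_closed).
- exact: (zmod_setB Ucl).
- by rewrite jAB opprD addrACA.
Qed.

Lemma sumset_act g a : sumset a -> sumset (acs g a).
Proof.
move=> [b [u [Ab Uu ->]]]; have [c Ac cE] := act_jA0 g Ab.
by exists c, (acs g u); split; rewrite ?act_D ?cE//; exact: Uact.
Qed.

Lemma sumset_U a : U a -> sumset a.
Proof.
by move=> Ua; exists 0, a; rewrite jA0 add0r; split=> //;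
  exact: (zmod_set0 A0_closed).
Qed.

Lemma sumset_hs x y : sumset (hs x y).
Proof.
have [a Aa ->] := hsA0 x y; exists a, 0; rewrite addr0; split=> //.
exact: (zmod_set0 Ucl).
Qed.

Definition sum_ext : set Es := [set x | sumset x.1].

Lemma sum_ext_closed : group_closed (mem sum_ext).
Proof.
exact: fiber_group_closed sumset_closed sumset_act sumset_hs.
Qed.

Lemma sum_ext_div (x y : Es) : U (y.1 - x.1) -> sum_ext (x^-1 * y)%g.
Proof.
move=> Uxy; set z := (x^-1 * y)%g.
have yE : y = (x * z)%g by rewrite mulVKg.
have : sumset (acs x.2 z.1).
  have -> : acs x.2 z.1 = y.1 - x.1 - hs x.2 z.2.
    have -> : y.1 = x.1 + acs x.2 z.1 + hs x.2 z.2 by rewrite {1}yE.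
    by rewrite addrAC addrK addrC addKr.
  apply: (zmod_setB sumset_closed); [exact: sumset_U|exact: sumset_hs].
by move=> /(sumset_act x.2^-1%g); rewrite -act_M mulVg act_1.
Qed.

Section Splitting.
Variable E : set Es.
Hypotheses (Ecl : group_closed (mem E)) (Esub : E `<=` sum_ext)
  (Esurj : forall g, exists a, E (a, g)).

(** The trace on [A0], up to [U], of the kernel of the projection of [E]. *)
Definition obstruction : set A :=
  [set a | A0 a /\ exists2 u, U u & E (jA a + u, 1%g)].

Lemma obstruction_closed : zmod_closed (mem obstruction).
Proof.
apply/zmod_closedP; split.
  split; first exact: (zmod_set0 A0_closed).
  by exists 0; [exact: (zmod_set0 Ucl)|rewrite jA0 addr0;
    exact: (group_set1 Ecl)].
move=> a b [Aa [u Uu Ea]] [Ab [v Uv Eb]]; split;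
  first exact: (zmod_setB A0_closed).
exists (u - v); first exact: (zmod_setB Ucl).
rewrite jAB addrACA -opprD -(ext_div_kernel hs _ _ 1%g).
exact: (group_setMV Ecl).
Qed.

Lemma obstruction_act g a : obstruction a -> obstruction (ac g a).
Proof.
move=> [Aa [u Uu Ea]]; split; first exact: act_A0.
exists (acs (jG g) u); first exact: Uact.
have [b Eb] := Esurj (jG g).
rewrite jact -act_D -(ext_conj_kernel hs _ b).
by apply: (group_setMV Ecl) => //; exact: (group_setM Ecl).
Qed.

(** Choosing a point of [E] over each element of the group, and taking its
component in [A0], splits the cocycle up to the ambiguity of the choice. *)
Lemma split_modulo_obstruction : exists f : G -> A,
  [/\ forall g, A0 (f g), f 1%g = 0 &
   forall x y, obstruction (h x y - (f x + ac x (f y) - f (x * y)%g))].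
Proof.
pose R g a := A0 a /\ exists2 u, U u & E (jA (- a) + u, jG g).
(* As [E] contains [(0, 1)], one may choose [0] over the neutral element. *)
have R1 : R 1%g 0.
  split; first exact: (zmod_set0 A0_closed).
  by exists 0; [exact: (zmod_set0 Ucl)|rewrite oppr0 jA0 addr0 jG1;
    exact: (group_set1 Ecl)].
have [f fR f1] : exists2 f, forall g, R g (f g) & f 1%g = 0.
  have [f fR] : {f : G -> A & forall g, R g (f g)}.
    apply: choice => g; have [b Eb] := Esurj (jG g).
    have [a [u [Aa Uu /= bE]]] := Esub Eb.
    exists (- a); split; first exact: (zmod_setN A0_closed).
    by exists u => //; rewrite opprK -bE.
  exists (fun g => if g == 1%g then 0 else f g); last by rewrite eqxx.
  by move=> g; case: eqP => [->|].
exists f; split=> // [g|x y]; first by have [] := fR g.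
have [Afx [u Uu Ex]] := fR x; have [Afy [v Uv Ey]] := fR y.
have [Afxy [w Uw Exy]] := fR (x * y)%g.
split.
  apply: (zmod_setB A0_closed); first exact: hA0.
  apply: (zmod_setB A0_closed) => //; apply: (zmod_setD A0_closed) => //.
  exact: act_A0.
exists (u + acs (jG x) v - w).
  by apply: (zmod_setB Ucl) => //; apply: (zmod_setD Ucl) => //; exact: Uact.
have := group_setM Ecl Ex Ey; rewrite ext_mulE /= -jGM => Exy'.
have := group_setMV Ecl Exy' Exy; rewrite ext_div_kernel; congr (E (_, _)).
rewrite !jAN !jAB !jAD jact jh act_D act_N.
rewrite !opprD !opprK !addrA.
by rewrite [LHS](ACl (5 * 1 * 3 * 6 * 2 * 4 * 7)%AC).
Qed.

End Splitting.
End Subgroup.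
End PullBack.

(** * The components of the extension *)

Section MonsterExtension.
Variables (L : signature) (M : structure L)
  (n m : nat) (F : module_formulas L n m)
  (G : groupType) (A : zmodType) (ac : autAction G A)
  (iG : G -> ('I_n -> M)) (iA : A -> ('I_m -> M)).
Hypothesis (hF : interprets F ac iG iA).
Variables (B : set M) (h : cocycle ac) (ph : formula L ('I_n + 'I_n + 'I_m +
  B)).
Hypotheses (hph : interprets_cocycle ph (fun b : B => val b) iG iA h)
  (hfin : finite_set (coc_image h))
  (hdcl : forall a, coc_image h a -> forall i, dcl B (iA a i)).
Variable A0 : set A.
Hypothesis A0E : A0 = generated (coc_image h).
Variables (K : Type) (N : structure L) (e : M -> N).
Hypothesis hN : monster K e.
Variables (Gs : groupType) (As : zmodType) (acs : autAction Gs As)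
  (iGs : Gs -> ('I_n -> N)) (iAs : As -> ('I_m -> N)).
Hypothesis (hFs : interprets F acs iGs iAs).
Variable hs : cocycle acs.
Hypothesis (hphs : interprets_cocycle ph (fun b : B => e (val b)) iGs iAs hs).
Variables (jA : A -> As) (jG : G -> Gs).
Hypotheses (jAP : forall a, iAs (jA a) = e \o iA a)
  (jAD : {morph jA : a b / a + b}) (jGM : {morph jG : x y / (x * y)%g})
  (jAI : injective jA)
  (jact : forall g a, jA (ac g a) = acs (jG g) (jA a))
  (jh : forall x y, jA (h x y) = hs (jG x) (jG y)).
Hypothesis A0tf : torsion_free A0.
Local Notation Es := (extension hs).
Local Notation iE := (ext_incl iGs iAs (h := hs)).
Local Notation Bs := (e @` B).

Let eE : elementary e. Proof. by have [] := hN. Qed.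
Let Nsat : saturated K N. Proof. by have [] := hN. Qed.
Let Kinf := monster_infinite hN.
Let BsM0 : Bs `<=` range e. Proof. by move=> _ [b _ <-]; exists b. Qed.
Let Bsm : small K Bs. Proof. exact: small_sub BsM0 (small_submodel hN). Qed.

Let hsE x y : exists2 a, coc_image h a & hs x y = jA a.
Proof. exact: (coc_image_transfer eE hF hFs hph hphs jAP hfin). Qed.

Let sigmaA s : automorphism s -> (forall c, Bs c -> s c = c) ->
  exists2 sA : As -> As, forall x, iAs (sA x) = s \o iAs x & {morph sA : x y /
    x + y}.
Proof.
move=> sA _; have [sX [_ [sXE _ sXD _ _]]] := induced_automorphism hFs sA.
by exists sX.
Qed.

Let sigmaE s : automorphism s -> (forall c, Bs c -> s c = c) ->
  exists2 sX : Es -> Es, forall x, iE (sX x) = s \o iE x &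
    {morph sX : x y / (x * y)%g}.
Proof.
move=> sA sB.
have [|sX [sXE sXM]] := induced_extension_automorphism hFs hphs sA.
  by move=> b; apply: sB; exists (val b) => //; exact: set_valP.
by exists sX.
Qed.

Lemma A0_fixed s : automorphism s -> (forall c, Bs c -> s c = c) ->
  forall a, A0 a -> s \o iAs (jA a) = iAs (jA a).
Proof.
move=> sA sB a; rewrite A0E => /generated_sub.
have [sX sXE sXD] := sigmaA sA sB.
have sX0 : sX 0 = 0 by apply: (addrI (sX 0)); rewrite -sXD !addr0.
have sXB x y : sX (x - y) = sX x - sX y.
  by apply/esym/eqP; rewrite subr_eq -sXD subrK.
move=> /(_ [set a | sX (jA a) = jA a]); rewrite -sXE => -> //.
  apply/zmod_closedP; split=> [|x y /= Hx Hy]; first by rewrite /= (jA0 jAD).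
  by rewrite (jAB jAD) sXB Hx Hy.
move=> x hx /=; apply: (iA_inj hFs); rewrite sXE jAP; apply: funext => i /=.
apply: (dcl_fixed eE sA) (hdcl hx i).
by move=> b Bb; apply: sB; exists b.
Qed.

Section Subgroup.
Variable U : set As.
Hypotheses (Ucl : zmod_closed (mem U)) (Ubdd : bounded_index_add K U)
  (Uinv : Aut_invariant Bs (iAs @` U)) (Uact : forall g a, U a -> U (acs g a)).

Lemma same_type_subgroup x y : same_type (range e) (iAs x) (iAs y) -> U (y - x).
Proof. exact: (same_type_bounded_index_add hN BsM0 (iA_inj hFs) sigmaA). Qed.

Lemma sum_ext_bounded_index : bounded_index K (sum_ext (hs := hs) jA A0 U).
Proof.
apply: (bounded_index_of_types hN (iX := iE)).
  exact: (sum_ext_closed jAD jh A0E hsE).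
move=> x y /(same_type_comp inl) xy.
apply: (sum_ext_div jAD jh A0E hsE) => //.
exact: same_type_subgroup.
Qed.

Lemma sum_ext_Aut_invariant : Aut_invariant Bs (iE @` sum_ext (hs :=
  hs) jA A0 U).
Proof.
move=> s sA sB _ [x [a [u [Aa Uu xE]]] <-].
have [sX [sG [sXE sGE sXD _ _]]] := induced_automorphism hFs sA.
exists (sX x.1, sG x.2).
  exists a, (sX u); split => //=.
    exact: (Aut_invariant_map (iA_inj hFs) Uinv sA sB sXE).
  rewrite xE sXD; congr (_ + _).
  by apply: (iA_inj hFs); rewrite sXE A0_fixed.
by rewrite /ext_incl /= sXE sGE comp_join.
Qed.

End Subgroup.

Lemma group_closedI (X : groupType) (H H' : set X) : group_closed (mem H) ->
  group_closed (mem H') -> group_closed (mem (H `&` H')).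
Proof.
move=> Hcl H'cl; apply/group_closedP; split.
  by split; [exact: (group_set1 Hcl)|exact: (group_set1 H'cl)].
by move=> x y [? ?] [? ?]; split;
  [exact: (group_setMV Hcl)|exact: (group_setMV H'cl)].
Qed.

Lemma snd_closed (H : set Es) : group_closed (mem H) ->
  group_closed (mem (snd @` H : set Gs)).
Proof.
move=> Hcl; apply/group_closedP; split; first by exists 1%g;
  first exact: (group_set1 Hcl).
move=> _ _ [x Hx <-] [y Hy <-].
by exists (x * y^-1)%g; first exact: (group_setMV Hcl).
Qed.

Lemma snd_bounded_index (H : set Es) : bounded_index K H ->
  bounded_index K (snd @` H : set Gs).
Proof.
move=> /(small_image (fun W : set Es => snd @` W : set Gs)).
apply: small_sub => _ [g _ <-]; exists [set (((0, g) : Es) * y)%g | y in H].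
  by exists (0, g).
apply/seteqP; split=> [_ [_ [y Hy <-] <-]|_ [_ [y Hy <-] <-]].
  by exists y.2 => //; exists y.
by exists (((0, g) : Es) * y)%g => //; exists y.
Qed.

Lemma snd_Aut_invariant (H : set Es) : Aut_invariant Bs (iE @` H) ->
  Aut_invariant Bs (iGs @` (snd @` H)).
Proof.
move=> Hinv s sA sB _ [_ [x Hx <-] <-].
have [|y Hy yE] := Hinv s sA sB (iE x); first by exists x.
exists y.2; first by exists y.
by apply: funext => i; have := congr1 (@^~ (inr i)) yE.
Qed.

Definition kernel (H : set Es) : set As := [set a | H (a, 1%g)].

Lemma kernel_closed (H : set Es) : group_closed (mem H) ->
  zmod_closed (mem (kernel H)).
Proof.
move=> Hcl; apply/zmod_closedP; split; first exact: (group_set1 Hcl).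
move=> x y Hx Hy; have := group_setMV Hcl Hx Hy.
by rewrite ext_div_kernel.
Qed.

Lemma kernel_bounded_index (H : set Es) : group_closed (mem H) ->
  bounded_index K H ->
  bounded_index_add K (kernel H).
Proof.
move=> Hcl /(small_image (fun W : set Es => [set a | W (a, 1%g)])).
apply: small_sub => _ [a _ <-]; exists [set (((a, 1%g) : Es) * y)%g | y in H].
  by exists (a, 1%g).
apply/seteqP; split=> [b [[c k] Hc]|_ [c Hc <-]].
  rewrite ext_mul_kernel => -[<- k1]; exists c => //.
  by rewrite k1 in Hc.
by exists (c, 1%g) => //; exact: ext_mul_kernel.
Qed.

Lemma kernel_act (H : set Es) g a : group_closed (mem H) ->
  (forall g, exists a, H (a, g)) -> kernel H a -> kernel H (acs g a).
Proof.
move=> Hcl Hsurj Ha; have [b Hb] := Hsurj g.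
have := group_setMV Hcl (group_setM Hcl Hb Ha) Hb.
by rewrite ext_conj_kernel.
Qed.

Section Divisibility.
Variables (A1 : set As) (E : set Es).
Hypotheses (A1cl : zmod_closed (mem A1)) (A1td : type_definable Bs (iAs @` A1))
  (A1A0 : forall a, A0 a -> A1 (jA a) -> a = 0).
Hypotheses (Ecl : group_closed (mem E)) (Etd : type_definable Bs (iE @` E))
  (Esub : E `<=` sum_ext (hs := hs) jA A0 A1).
Local Notation P := (obstruction (hs := hs) jA A0 A1 E).
Let A0cl : zmod_closed (mem A0) := A0_closed A0E.

Let residual q a : (1 < q)%N ->
  (forall k, exists2 c, A0 c & a = c *+ (q ^ k)) -> a = 0.
Proof. by rewrite A0E; apply: generated_residual => //; rewrite -A0E. Qed.

(** Let [t0] be an element of the kernel with component [a]. The affine map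
[y |-> t0 - 2 y] has the fixed point [t0 / 3] and contracts 2-adically: modulo
[A1], the [k]-th image of the kernel consists of elements [z] such that
[3 z - t0] is divisible by [2 ^ k]. These images form a decreasing sequence of
nonempty type-definable sets. The component [b] of a common point satisfies
[3 b = a], because [A0] has no nonzero element that is divisible by all powers
of 2. *)
Lemma obstruction_div3 a : P a -> exists2 b, P b & a = b *+ 3.
Proof.
move=> [Aa [u A1u Eau]]; set t0 := jA a + u.
pose T := kernel E.
(* The image of [Y] under [y |-> t0 - 2 y], up to an error [v] in [A1]. *)
pose step (Y : set As) := [set z | T z /\
  exists y v, [/\ Y y, A1 v & z + y + y = t0 + v]].
pose Y k := iter k step T.
pose C := Bs `|` range (iAs t0).
have Csm : small K C by apply: (small_setU Kinf) => //;
  exact: (small_range Kinf).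
have up (D : set As) : type_definable Bs (iAs @` D) ->
  type_definable C (iAs @` D).
  by apply: type_definable_sub; exact: subsetUl.
have Ttd : type_definable Bs (iAs @` T).
  exact: (type_definable_kernel hFs Kinf Nsat Bsm).
have Ytd k : type_definable C (iAs @` Y k).
  elim: k => [|k IHk]; first exact: up.
  apply: (type_definable_step hFs Kinf Nsat Csm) => //; [|exact: up..].
  by move=> i; right; exists i.
have YT k : Y k `<=` T by case: k => [//|k] z [].
have Ydecr k : Y k.+1 `<=` Y k.
  elim: k => [|k IHk]; first exact: (YT 1%N).
  by move=> z [Tz [y [v [Yy A1v zy]]]]; split=> //; exists y, v; split=> //;
    exact: IHk.
have Tcl := kernel_closed Ecl.
have Tt0 : T t0 by [].
have Y0 k : Y k !=set0.
  elim: k => [|k [y Yy]]; first by exists t0.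
  have Ty := YT _ _ Yy.
  exists (t0 - y - y); split; first by apply: (zmod_setB Tcl) => //;
    exact: (zmod_setB Tcl).
  by exists y, 0; split=> //; [exact: (zmod_set0 A1cl)|rewrite !subrK addr0].
have [|k _ [y Yy <-]|k|x xY] := @compactness_decreasing K L N Nsat C 'I_m
   (fun k => iAs @` Y k) Csm.
- exact: Ytd.
- by exists y => //; exact: Ydecr.
- by have [y Yy] := Y0 k; exists (iAs y), y.
have [t Tt tx] := xY 0%N.
have Yt k : Y k t by have [z Yz] := xY k; rewrite -tx => /(iA_inj hFs) <-.
have comp z : T z -> exists b v, [/\ A0 b, A1 v & z = jA b + v] by move=> /Esub.
have [b [v [Ab A1v tE]]] := comp t Tt.
exists b; first by split=> //; exists v => //; rewrite -tE.
(* [3 c - a = 3 (a - 2 c') - a = - 2 (3 c' - a)] when [z] comes from [y]. *)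
have key k z c w : Y k z -> A0 c -> A1 w -> z = jA c + w ->
    exists2 d, A0 d & c *+ 3 - a = d *+ (2 ^ k).
  elim: k z c w => [|k IHk] z c w Yz Ac A1w zE.
    exists (c *+ 3 - a); last by rewrite expn0 mulr1n.
    by rewrite !mulrS mulr0n addr0; do !apply: (zmod_setB A0cl) => //;
       do !apply: (zmod_setD A0cl) => //.
  have [_ [y [r [Yy A1r zy]]]] := Yz.
  have [c' [w' [Ac' A1w' yE]]] := comp y (YT _ _ Yy).
  have [d Ad dE] := IHk y c' w' Yy Ac' A1w' yE.
  exists (- d); first exact: (zmod_setN A0cl).
  have cc' : c + c' + c' - a = 0.
    apply: A1A0.
      by apply: (zmod_setB A0cl) => //; do !apply: (zmod_setD A0cl) => //.
    rewrite (jAB jAD) !jAD.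
    have -> : jA c + jA c' + jA c' - jA a = u + r - w - w' - w'.
      apply/eqP; rewrite subr_eq; apply/eqP.
      apply: (addIr (w + w' + w')).
      have -> : jA c + jA c' + jA c' + (w + w' + w') = z + y + y.
        by rewrite zE yE !addrA [RHS](ACl (1 * 3 * 5 * 2 * 4 * 6)%AC).
      rewrite zy /t0 !addrA.
      rewrite [RHS](ACl (6 * 1 * 2 * (3 * 7) * (4 * 8) * (5 * 9))%AC) /=.
      by rewrite !addNr !addr0.
    do !apply: (zmod_setB A1cl) => //.
    by apply: (zmod_setD A1cl).
  have aE : a = c + c' + c' by apply/eqP; rewrite eq_sym -subr_eq0 cc'.
  have c'E : c' *+ 3 - a = c' - c.
    apply/eqP; rewrite subr_eq aE !addrA subrK.
    by rewrite !mulrS mulr0n addr0 addrA.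
  have cE : c *+ 3 - a = (c - c') *+ 2.
    apply/eqP; rewrite subr_eq aE mulr2n !addrA.
    rewrite [X in _ == X](ACl (1 * 3 * 5 * (2 * 6) * (4 * 7))%AC) /= addNr
      !addr0.
    by rewrite !mulrS mulr0n addr0 addrA.
  by rewrite expnS mulnC mulrnA mulNrn -dE c'E opprB cE.
apply/esym/eqP; rewrite -subr_eq0; apply/eqP;
  apply: (residual (q := 2)) => // k.
exact: (key k t b v).
Qed.

Lemma obstruction_eq0 a : P a -> a = 0.
Proof.
move=> Pa; apply: (residual (q := 3)) => // k.
suff [c [Ac _] aE] : exists2 c, P c & a = c *+ 3 ^ k by exists c.
elim: k => [|k [c Pc aE]]; first by exists a; rewrite // expn0 mulr1n.
have [d Pd dE] := obstruction_div3 Pc; exists d => //.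
by rewrite aE dE expnS mulrnA.
Qed.

End Divisibility.

Lemma split_in_quotient (Z : zmodClosed A) (f : G -> A) :
  (forall g z, z \in Z -> ac g z \in Z) -> (forall g, A0 (f g)) -> f 1%g = 0 ->
  (forall x y, h x y - (f x + ac x (f y) - f (x * y)%g) \in Z) ->
  split_in (quot_act ac Z) (quot_coc Z h) (quot_image Z A0).
Proof.
move=> Zact Af f1 fZ; exists (fun g => \pi_({ideal_quot Z})%qT (f g)); split.
- by move=> g; exists (f g).
- by rewrite f1 raddf0.
- move=> x y; rewrite quot_actE// -raddfD -raddfB; apply/eqmodP => /=.
  by rewrite Quotient.equivE.
Qed.

Section Conclusion.
Variable A1 : set As.
Hypotheses (A1cl : zmod_closed (mem A1)) (A1bdd : bounded_index_add K A1)
  (A1td : type_definable Bs (iAs @` A1)) (A1act : forall g a, A1 a ->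
    A1 (acs g a))
  (A1A0 : forall a, A0 a -> A1 (jA a) -> a = 0)
  (G00 : is_component00 K Bs iGs [set: Gs]).
Let iEI : injective iE := iE_inj hFs (h := hs).
Let rangetd : type_definable Bs (range iE) := type_definable_range_iE hs hFs Bs.

(** The projection is type-definable by saturation, hence it contains the
type-definable component of [Gs]. *)
Lemma snd_surjective (H : set Es) : group_closed (mem H) -> bounded_index K H ->
  type_definable Bs (iE @` H) -> forall g, exists a, H (a, g).
Proof.
move=> Hcl Hbdd Htd g; have [_ Gmin] := G00.
have [|[a k] Hak /= <-] := Gmin (snd @` H) _ g I; last by exists a.
split.
- exact: snd_closed.
- exact: snd_bounded_index.
exact: (type_definable_snd Kinf Nsat Bsm Htd).
Qed.

Lemma component000_neq_component00 : ~ split_in ac h A0 ->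
  exists E000 E00 : set Es,
     [/\ is_component000 K Bs iE E000, is_component00 K Bs iE E00 & E000 <>
       E00].
Proof.
move=> Nsplit.
have [E000 E000P] := exists_component000 hN BsM0 iEI sigmaE.
have [E00 E00P] := exists_component00 hN BsM0 iEI sigmaE rangetd.
exists E000, E00; split=> // EE; apply: Nsplit.
have [[Ecl Ebdd Etd] _] := E00P.
have [_ Emin] := E000P.
have A1inv := type_definable_Aut_invariant A1td.
have Esub : E00 `<=` sum_ext jA A0 A1.
  rewrite -EE; apply: Emin; split; [exact: (sum_ext_closed jAD jh A0E hsE)|..].
    exact: sum_ext_bounded_index.
  exact: sum_ext_Aut_invariant.
have Esurj := snd_surjective Ecl Ebdd Etd.
have [f [Af f1 fP]] :=
  split_modulo_obstruction jAI jAD jGM jact jh A0E hsE A1cl A1act Ecl Esub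
    Esurj.
exists f; split=> // x y; apply/eqP; rewrite -subr_eq0; apply/eqP.
exact: (obstruction_eq0 A1cl A1td A1A0 Ecl Etd Esub (fP x y)).
Qed.

Lemma component00_full : is_component000 K Bs iGs [set: Gs] ->
   (forall Z : zmodClosed A, [set z | z \in Z] `<` A0 ->
      ~ split_in (quot_act ac Z) (quot_coc Z h) (quot_image Z A0)) ->
   (forall H : set As, zmod_closed (mem H) -> bounded_index_add K H ->
      type_definable Bs (iAs @` H) -> jA @` A0 `<=` H -> H = [set: As]) ->
   is_component00 K Bs iE [set: Es].
Proof.
move=> G000 Nsplit Hfull.
have Tcl : group_closed (mem [set: Es]) by apply/group_closedP.
split; first by split=> //; apply: (bounded_index_of_types hN (iX := iE)).
move=> H [Hcl Hbdd Htd].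
have Hinv := type_definable_Aut_invariant Htd.
have Hsurj := snd_surjective Hcl Hbdd Htd.
have kerHcl := kernel_closed Hcl.
have kerHbdd := kernel_bounded_index Hcl Hbdd.
have kerHtd : type_definable Bs (iAs @` kernel H).
  exact: (type_definable_kernel hFs Kinf Nsat Bsm).
pose U := A1 `&` kernel H.
have Ucl : zmod_closed (mem U).
  apply/zmod_closedP; split.
    by split; [exact: (zmod_set0 A1cl)|exact: (zmod_set0 kerHcl)].
  by move=> x y [? ?] [? ?]; split;
    [exact: (zmod_setB A1cl)|exact: (zmod_setB kerHcl)].
have A1inv := type_definable_Aut_invariant A1td.
have kerHinv := type_definable_Aut_invariant kerHtd.
have Ubdd : bounded_index_add K U.
  apply: (bounded_index_add_of_types hN (iX := iAs) Ucl) => x y xy.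
  by split; [exact: (same_type_subgroup A1cl)|exact: (same_type_subgroup
    kerHcl)].
have Uinv : Aut_invariant Bs (iAs @` U).
  move=> s sA sB _ [x [A1x Hx] <-]; have [sX sXE _] := sigmaA sA sB.
  exists (sX x); last exact: sXE.
  split; first exact: (Aut_invariant_map (iA_inj hFs) A1inv sA sB sXE).
  exact: (Aut_invariant_map (iA_inj hFs) kerHinv sA sB sXE).
have Uact g a : U a -> U (acs g a).
  by move=> [A1a Ha]; split; [exact: A1act|exact: kernel_act].
(* Cutting [H] down to [sum_ext] loses type-definability and keeps invariance,
   which is why the invariant component of [Gs] has to be everything. *)
pose S := sum_ext (hs := hs) jA A0 U.
have Scl : group_closed (mem S) := sum_ext_closed jAD jh A0E hsE Ucl Uact.
have Sbdd : bounded_index K S by exact: sum_ext_bounded_index.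
have Sinv : Aut_invariant Bs (iE @` S) by exact: sum_ext_Aut_invariant.
pose E := H `&` S.
have Ecl : group_closed (mem E) := group_closedI Hcl Scl.
have Ebdd : bounded_index K E.
  apply: (bounded_index_of_types hN (iX := iE) Ecl) => x y xy.
  by split; exact: (same_type_bounded_index hN BsM0 iEI sigmaE _ _ _ xy).
have Einv : Aut_invariant Bs (iE @` E).
  move=> s sA sB _ [x [Hx Sx] <-]; have [sX sXE _] := sigmaE sA sB.
  exists (sX x); last exact: sXE.
  split; first exact: (Aut_invariant_map iEI Hinv sA sB sXE).
  exact: (Aut_invariant_map iEI Sinv sA sB sXE).
have Esurj g : exists a, E (a, g).
  have [_ Gmin] := G000.
  have [|[a k] Eak /= <-] := Gmin (snd @` E) _ g I; last by exists a.
  split; [exact: snd_closed|exact: snd_bounded_index|exact: snd_Aut_invariant].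
have Esub : E `<=` S by move=> x [].
have [f [Af f1 fP]] :=
  split_modulo_obstruction jAI jAD jGM jact jh A0E hsE Ucl Uact Ecl Esub Esurj.
pose P := obstruction (hs := hs) jA A0 U E.
have Pcl : zmod_closed (mem P) := obstruction_closed jAD A0E Ucl Ecl.
have PA0 : P = A0.
  apply: contrapT => PA0.
  pose Zmix := GRing.isZmodClosed.Build A (mem P : {pred A}) Pcl.
  pose Z : zmodClosed A := HB.pack (mem P : {pred A}) Zmix.
  have ZP z : z \in Z <-> P z by split=> [/set_mem|/mem_set].
  apply: (Nsplit Z).
    split; first by move=> z /ZP [].
    move=> A0P; apply: PA0; apply/seteqP; split=> [z []//|z Az].
    exact/ZP/A0P.
  apply: (@split_in_quotient Z f) => // [g z /ZP Pz|x y]; last by apply/ZP;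
    exact: fP.
  by apply/ZP; apply: (obstruction_act jAI jAD jact jh A0E hsE Uact Ecl Esurj).
have kerHT : kernel H = [set: As].
  apply: Hfull => // _ [a Aa <-].
  (* As [u] lies in the kernel of [H], so does [jA a]. *)
  have [_ [u [_ Hu] [Eau _]]] : P a by rewrite PA0.
  have -> : jA a = (jA a + u) - u by rewrite addrK.
  exact: (zmod_setB kerHcl).
move=> [a g] _; have [b Hb] := Hsurj g.
have Hab : kernel H (a - b) by rewrite kerHT.
by have := group_setM Hcl Hab Hb; rewrite ext_mul_kernel subrK.
Qed.

End Conclusion.
End MonsterExtension.

(** * The theorem *)

Theorem corollary2p3
  (L : signature) (M : structure L)
  (n m : nat) (F : module_formulas L n m)
  (G : groupType) (A : zmodType) (ac : autAction G A)
  (iG : G -> ('I_n -> M)) (iA : A -> ('I_m -> M))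
  (hF : interprets F ac iG iA)
  (B : set M) (Bfin : finite_set B)
  (h : cocycle ac) (ph : formula L ('I_n + 'I_n + 'I_m + B))
  (hph : interprets_cocycle ph (fun b : B => val b) iG iA h)
  (hfin : finite_set (coc_image h))
  (hdcl : forall a, coc_image h a -> forall i, dcl B (iA a i))
  (A0 : set A) (A0E : A0 = generated (coc_image h))
  (K : Type) (N : structure L) (e : M -> N) (hN : monster K e)
  (Gs : groupType) (As : zmodType) (acs : autAction Gs As)
  (iGs : Gs -> ('I_n -> N)) (iAs : As -> ('I_m -> N))
  (hFs : interprets F acs iGs iAs)
  (hs : cocycle acs)
  (hphs : interprets_cocycle ph (fun b : B => e (val b)) iGs iAs hs)
  (Bs : set N) (BsE : Bs = e @` B)
  (A0s : set As) (A0sE : A0s = transfer e iA iAs A0)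
  (A1 : set As) (A1sub : zmod_closed (mem A1))
  (A1bdd : bounded_index_add K A1)
  (A1def : type_definable Bs (iAs @` A1))
  (A1inv : forall g a, A1 a -> A1 (acs g a))
  (H1 : ~ split_in ac h A0)
  (H2 : A1 `&` A0s = [set 0]) (H2' : torsion_free A0)
  (H3 : is_component00 K Bs iGs [set: Gs]) :
  (exists E000 E00 : set (extension hs),
     [/\ is_component000 K Bs (ext_incl iGs iAs (h := hs)) E000,
         is_component00 K Bs (ext_incl iGs iAs (h := hs)) E00 &
         E000 <> E00])
  /\
  (is_component000 K Bs iGs [set: Gs] ->
   (forall Z : zmodClosed A, [set z | z \in Z] `<` A0 ->
      ~ split_in (quot_act ac Z) (quot_coc Z h) (quot_image Z A0)) ->
   (forall H : set As, zmod_closed (mem H) -> bounded_index_add K H ->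
      type_definable Bs (iAs @` H) -> A0s `<=` H -> H = [set: As]) ->
   is_component00 K Bs (ext_incl iGs iAs (h := hs))
     [set: extension hs]).
Proof.
have eE : elementary e by have [] := hN.
have [jA [jG [[jAP jAD] jGM jAI jact jh]]] :=
  exists_transfer_maps eE hF hFs hph hphs.
have A0sP : A0s = jA @` A0.
  rewrite A0sE; apply/seteqP; split=> [y [a Aa ya]|_ [a Aa <-]]; exists a => //.
  by apply: (iA_inj hFs); rewrite ya jAP.
have A1A0 a : A0 a -> A1 (jA a) -> a = 0.
  move=> Aa A1a; apply: jAI; rewrite (jA0 jAD).
  have : (A1 `&` A0s) (jA a) by split; rewrite ?A0sP//; exists a.
  by rewrite H2.
subst Bs; rewrite A0sP; split.
  exact: (component000_neq_component00 hF hph hfin hdcl A0E hN hFs hphs jAP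
    jAD jGM jAI jact jh H2' A1sub A1bdd A1def A1inv A1A0 H3 H1).
exact: (component00_full hF hph hfin hdcl A0E hN hFs hphs jAP
  jAD jGM jAI jact jh A1sub A1bdd A1def A1inv H3).
Qed.
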